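(* Let $\mathcal P$ be a Polish space and let $(\mathcal R_x, x\in\mathcal P)$ be a replacement kernel such that, for every $x\in\mathcal P$, $\mathcal R_x$ is a non-negative Borel measure on $\mathcal P$ with $\mathcal R_x(\mathcal P)=1$. Assume that there exists a pair of sequences $(a(n),b(n))_{n\ge 0}$ such that: (a) the companion Markov chain $(W_n)_{n\ge 0}$ with transition kernel $K(x,A)=\mathcal R_x(A)$ is $(a(n),b(n))_{n\ge0}$-ergodic, with limiting distribution $\gamma$; (b) there are measurable functions $f:\mathbb R\to\mathcal P$ and $g$ (taking values in the set of scalars to which the $a(n)$ belong) such that, for (Lebesgue-almost) every $x\in\mathbb R$ and every sequence $\varepsilon_n=o(\sqrt n)$, $$\frac{b(\lfloor n+x\sqrt n+\varepsilon_n\rfloor)-b(n)}{a(n)}\to f(x),\qquad \frac{a(\lfloor n+x\sqrt n+\varepsilon_n\rfloor)}{a(n)}\to g(x)\qquad (n\to\infty).$$ Then, for every finite measure $\mathcal M_0$ on $\mathcal P$ with $0<\mathcal M_0(\mathcal P)<+\infty$, the $(\mathcal M_0,(\mathcal R_x,x\in\mathcal P))$-measure-valued Pólya process $(\mathcal M_n)_{n\ge0}$ satisfies $$\Theta_{a(\log n),\,b(\log n)}\left(n^{-1}\mathcal M_n\right)\longrightarrow \nu\quad\text{in probability as } n\to\infty,$$ for the topology of weak convergence on the space $\mathcal M(\mathcal P)$ of measures on $\mathcal P$, where $\nu$ is the distribution of $\Gamma g(\Lambda)+f(\Lambda)$, with $\Lambda$ a $\mathcal N(0,1)$ random variable and $\Gamma\sim\gamma$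 independent of $\Lambda$.
   Context: Measure-valued Pólya process (MVPP): given a finite non-negative Borel measure $\mathcal M_0$ on $\mathcal P$ with $0<\mathcal M_0(\mathcal P)<\infty$ and a kernel $(\mathcal R_x,x\in\mathcal P)$ of non-negative Borel measures, the $(\mathcal M_0,(\mathcal R_x))$-MVPP is the Markov chain $(\mathcal M_n)_{n\ge0}$ of measures defined as follows: given $\mathcal M_n$, draw a random colour $C_n$ with law $\mathcal M_n/\mathcal M_n(\mathcal P)$, and, conditionally on $C_n=C$, set $\mathcal M_{n+1}=\mathcal M_n+\mathcal R_C$. Companion Markov chain: the $\mathcal P$-valued Markov chain $(W_n)$ such that, conditionally on $W_n=w$, $W_{n+1}$ has law $\mathcal R_w$. A Markov chain $(X_n)$ is $(a(n),b(n))_{n\ge0}$-ergodic, with limiting distribution $\gamma$, if for every initial distribution of $X_0$ the sequence $(X_n-b(n))/a(n)$ converges in distribution to $\gamma$, where $\gamma$ does not depend on the initial distribution. For a measure $\mu$ on $\mathcal P$, a scalar $a$ and $b\in\mathcal P$, $\Theta_{a,b}(\mu)$ is the measure defined by $\int f\,d\Theta_{a,b}(\mu)=\int f(a^{-1}(x-b))\,d\mu(x)$ for all measurable $f$. Conventions on the operations: if $\mathcal P$ has no subtraction operation, the only allowed choice is $b\equiv 0$, with $x-0:=x$; if $a(n)=1$ then $x/1:=x$. Otherwise the $a(n)$ belong to a set of scalars by which elements of $\mathcal P$ can be divided and whose quotients are well defined (typically $\mathcal P$ is a Banach space over $\mathbb R$ or $\mathbb C$ and the $a(n)$ are nonzero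 scalars). When $a\equiv1$ and $b\equiv0$, one has $g\equiv1$, $f\equiv0$, and $\Gamma g(\Lambda)+f(\Lambda)$ means $\Gamma$. For non-integer $t\ge 0$, $a(t)$ and $b(t)$ mean $a(\lfloor t\rfloor)$ and $b(\lfloor t\rfloor)$. *)

(* Defs.v *)
From HB Require Import structures.
From mathcomp Require Import all_boot all_order all_algebra.
From mathcomp Require Import all_classical all_reals all_analysis.
From mathcomp Require Import measurable_realfun.

Set Implicit Arguments.
Unset Strict Implicit.
Unset Printing Implicit Defensive.

Import Order.TTheory GRing.Theory Num.Theory.
Import numFieldNormedType.Exports.

Local Open Scope classical_set_scope.
Local Open Scope ring_scope.

Section polish_spaces.
Context (R : realType) (T : topologicalType).

Definition polish : Prop := exists d : T -> T -> R,
  [/\ [/\ forall x y, d x y = 0 <-> x = y,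
          forall x y, d x y = d y x
        & forall x y z, d x z <= d x y + d y z],
      forall (x : T) (A : set T),
        nbhs x A <-> exists2 e : R, 0 < e & [set y | d x y < e] `<=` A,
      forall u : nat -> T,
        (forall e : R, 0 < e -> exists N, forall m n,
           (N <= m)%N -> (N <= n)%N -> d (u m) (u n) < e) ->
        exists l : T, u @ \oo --> l
    & exists2 D : set T, countable D & dense D].

Lemma polish_second_countable : polish -> @second_countable T.
Proof.
move=> [d [[d0 dC dT] nbhsd _ [D cD dD]]].
have dxx x : d x x = 0 by apply/d0.
pose B x (n : nat) := [set y | d x y < n.+1%:R^-1].
have oB x n : open (B x n).
  rewrite openE => y /= By; apply/nbhsd; exists (n.+1%:R^-1 - d x y).
    by rewrite subr_gt0.
  by move=> z /= yz; rewrite /B /= (le_lt_trans (dT x y z))// -ltrBrDl.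
exists [set B xn.1 xn.2 | xn in D `*` [set: nat]].
  by apply: sub_countable (card_image_le _ _) _; exact: countableX.
split; first by move=> _ [[x n] _ <-].
move=> x A /nbhsd[e e0 eA].
have [n ne] : exists n : nat, (n.+1%:R^-1 : R) + n.+1%:R^-1 < e.
  exists (Num.truncn (2 / e)).
  rewrite -(mulr2n (_^-1)) -(mulr_natl (_^-1)).
  rewrite ltr_pdivrMr ?ltr0n// mulrC -ltr_pdivrMr//.
  exact: truncnS_gt.
have [y [By Dy]] : B x n `&` D !=set0.
  apply: dD; last exact: oB.
  by exists x; rewrite /B /= dxx invr_gt0.
exists (B y n); first by split; [exists (y, n)|rewrite /B /= dC].
apply: subset_trans eA => z /= yz.
by rewrite (le_lt_trans (dT x y z))// (lt_trans _ ne)// ltrD.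
Qed.

End polish_spaces.

Notation borel T := (g_sigma_algebraType (@open T)).

(* [T] need not be pointed here, contrary to [borel T]. *)
Definition borel_measurable d (X : measurableType d) (T : topologicalType)
    (f : X -> T) : Prop :=
  forall B, <<s @open T >> B -> measurable (f @^-1` B).

(* The operations used to renormalize points of a space [P]: points are
   translated by elements of [offsets] and multiplied by elements of [scalars],
   division being by the elements of [sunit]. The intended [offsets] is [P]
   itself when [P] has a subtraction, and otherwise the trivial group, whose
   only element is a formal 0 such that x - 0 = x; in the absence of a division
   [scalars] is {1} and x / 1 = x. See [banach_normalization] and
   [trivial_normalization]. *)
Record normalization (R : realType) (P : topologicalType) := Normalization {
  offsets : topologicalZmodType ;
  scalars : topologicalType ;
  offsets_polish : polish R offsets ;
  scalars_polish : polish R scalars ;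
  sone : scalars ;
  smul : scalars -> scalars -> scalars ;
  sinv : scalars -> scalars ;
  sunit : set scalars ;
  smulA : associative smul ;
  smulC : commutative smul ;
  smul1s : left_id sone smul ;
  smulVs : forall s, sunit s -> smul (sinv s) s = sone ;
  translate : P -> offsets -> P ;
  translate0 : forall x, translate x 0 = x ;
  translateD : forall x v w, translate x (v + w) = translate (translate x v) w ;
  translate_continuous : continuous (fun z : P * offsets => translate z.1 z.2) ;
  dilate : scalars -> P -> P ;
  dilate1 : forall x, dilate sone x = x ;
  dilateM : forall s t x, dilate (smul s t) x = dilate s (dilate t x) ;
  dilate_continuous : continuous (fun z : scalars * P => dilate z.1 z.2) ;
  sdilate : scalars -> offsets -> offsets ;
  sdilate1 : forall v, sdilate sone v = v ;
  sdilateM : forall s t v, sdilate (smul s t) v = sdilate s (sdilate t v) ;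
  sdilateD : forall s v w, sdilate s (v + w) = sdilate s v + sdilate s w ;
  sdilate_continuous :
    continuous (fun z : scalars * offsets => sdilate z.1 z.2) ;
  dilate_translate : forall s x v,
    dilate s (translate x v) = translate (dilate s x) (sdilate s v) }.

Definition normalize (R : realType) (P : topologicalType)
    (N : normalization R P) (s : scalars N) (v : offsets N) (x : P) : P :=
  dilate (sinv s) (translate x (- v)).
Arguments normalize {R P} N s v x.

Section banach_normalization.
Context (R : realType) (K : numFieldType) (E : completeNormedModType K).
Hypotheses (pK : polish R K^o) (pE : polish R E).

Let scaleK_continuous : continuous (fun z : K^o * E => z.1 *: z.2).
Proof. exact: scale_continuous. Qed.

Definition banach_normalization : normalization R E :=
  @Normalization R E E K^o pE pK
    1 *%R GRing.inv [set s | s != 0]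
    (@mulrA K) (@mulrC K) (@mul1r K) (fun s s0 => mulVf s0)
    +%R (@addr0 E) (@addrA E) (@add_continuous E)
    *:%R (@scale1r K E) (fun s t x => esym (scalerA s t x)) scaleK_continuous
    *:%R (@scale1r K E) (fun s t x => esym (scalerA s t x))
    (@scalerDr K E) scaleK_continuous (@scalerDr K E).

Lemma banach_normalizeE (s : K) (v x : E) :
  normalize banach_normalization s v x = s^-1 *: (x - v).
Proof. by []. Qed.

End banach_normalization.

Definition trivial_group : Type := discrete_topology unit.

HB.instance Definition _ := Topological.copy trivial_group (discrete_topology unit).

Lemma trivial_group_eq (x y : trivial_group) : x = y.
Proof. by case: x; case: y. Qed.

Lemma trivial_group_continuous (T : topologicalType) (f : T -> trivial_group) :
  continuous f.
Proof.
move=> x; rewrite (_ : f = cst (f x)); first exact: cvg_cst.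
by apply/funext => y; exact: trivial_group_eq.
Qed.

HB.instance Definition _ := GRing.isZmodule.Build trivial_group
  (fun _ _ _ => trivial_group_eq _ _) (fun _ _ => trivial_group_eq _ _)
  (fun x => trivial_group_eq (tt : trivial_group) x)
  (fun x => @trivial_group_eq ((fun _ _ => tt) ((fun _ => tt) x) x) tt).
HB.instance Definition _ :=
  PreTopologicalNmodule_isTopologicalZmodule.Build trivial_group
  (@trivial_group_continuous _ _).

Lemma polish_trivial_group (R : realType) : polish R trivial_group.
Proof.
exists (fun _ _ => 0); split.
- split=> [x y|//|_ _ _]; last by rewrite addr0.
  by split=> // _; exact: trivial_group_eq.
- move=> x A; split=> [/nbhs_singleton Ax|[e e0]].
    by exists 1 => // y _; rewrite (trivial_group_eq y x).
  move=> eA; rewrite (_ : A = setT); first exact: filterT.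
  by apply/seteqP; split=> // y _; exact: eA.
- move=> u _; exists (u 0%N); rewrite (_ : u = cst (u 0%N)); first exact: cvg_cst.
  by apply/funext => n; exact: trivial_group_eq.
- exists setT; first exact: countableP.
  by move=> U [x Ux] _; exists x.
Qed.

Section trivial_normalization.
Context (R : realType) (P : topologicalType).

Definition trivial_normalization : normalization R P.
Proof.
refine (@Normalization R P trivial_group trivial_group
  (polish_trivial_group R) (polish_trivial_group R)
  tt (fun _ _ => tt) (fun _ => tt) setT _ _ _ _
  (fun x _ => x) _ _ _ (fun _ x => x) _ _ _ (fun _ _ => tt) _ _ _ _ _) => //;
  try by move=> *; exact: trivial_group_eq.
- by move=> x; exact: cvg_fst.
- by move=> x; exact: cvg_snd.
- exact: trivial_group_continuous.
Defined.

Lemma trivial_normalizeE (s v : trivial_group) (x : P) :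
  normalize trivial_normalization s v x = x.
Proof. by []. Qed.

End trivial_normalization.

Section measures_on_a_topological_space.
Context (R : realType) (P : ptopologicalType).

Definition finite_measures : Type := {finite_measure set (borel P) -> \bar R}.

HB.instance Definition _ := gen_eqMixin finite_measures.
HB.instance Definition _ := gen_choiceMixin finite_measures.

Definition bounded_continuous : Type :=
  {h : P -> R | continuous h /\ exists M, forall x, `|h x| <= M}.

Definition integrals (mu : finite_measures) : {ptws bounded_continuous -> R} :=
  fun h => \int[mu]_x sval h x.

Definition weak_measures : topologicalType := initial_topology integrals.

Definition cvg_in_distribution d (Omega : measurableType d)
    (Pr : probability Omega R) (X : nat -> Omega -> borel P)
    (gamma : probability (borel P) R) : Prop :=
  forall h : bounded_continuous,
    \int[Pr]_w sval h (X n w) @[n --> \oo] --> \int[gamma]_x sval h x.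

End measures_on_a_topological_space.

(* The outer measure spares the measurability of the events [Y n \notin U];
   it is [Pr] itself on measurable events. *)
Definition cvg_in_probability (R : realType) d (Omega : measurableType d)
    (Pr : probability Omega R) (T : topologicalType) (Y : nat -> Omega -> T)
    (y : T) : Prop :=
  forall U : set T, nbhs y U ->
    mu_ext Pr [set w | ~ U (Y n w)] @[n --> \oo] --> 0%E.

(* The sigma-algebra generated by X_0, ..., X_n, when [G] generates the
   sigma-algebra of the state space [E]. *)
Definition history (Omega E : Type) (G : set (set E)) (X : nat -> Omega -> E)
    (n : nat) : set (set Omega) :=
  <<s [set X k @^-1` B | k in `I_n.+1 & B in G] >>.

Section processes.
Local Open Scope ereal_scope.
Context (R : realType) (P : ptopologicalType).
Context d (Omega : measurableType d) (Pr : probability Omega R).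

Record markov_chain (mu : probability (borel P) R)
    (K : R.-pker (borel P) ~> (borel P)) (X : nat -> Omega -> borel P)
    : Prop := MarkovChain {
  markov_chain_measurable : forall n, measurable_fun setT (X n) ;
  markov_chain_init : forall A, measurable A -> Pr (X 0%N @^-1` A) = mu A ;
  markov_chain_step : forall n E A, history measurable X n E -> measurable A ->
    Pr (E `&` X n.+1 @^-1` A) = \int[Pr]_(w in E) K (X n w) A }.

Definition evaluation_sets : set (set (finite_measures R P)) :=
  [set [set mu : finite_measures R P | B (mu A)]
    | A in (measurable : set (set (borel P)))
    & B in (measurable : set (set (\bar R)))].

(* [C n] is the colour drawn at time [n], with law M_n / M_n(P) given
   M_0, ..., M_n. *)
Record mvpp (M0 : finite_measures R P) (K : R.-ker (borel P) ~> (borel P))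
    (C : nat -> Omega -> borel P) (M : nat -> Omega -> finite_measures R P)
    : Prop := Mvpp {
  mvpp_color_measurable : forall n, measurable_fun setT (C n) ;
  mvpp_init : forall w A, measurable A -> M 0%N w A = M0 A ;
  mvpp_step : forall n w A, measurable A ->
    M n.+1 w A = M n w A + K (C n w) A ;
  mvpp_color : forall n E A, history evaluation_sets M n E -> measurable A ->
    Pr (E `&` C n @^-1` A) =
      \int[Pr]_(w in E) (fine (M n w A) / fine (M n w setT))%:E }.

End processes.

(* The law of a Markov chain being determined by its initial law and its
   kernel, "some chain" and "every chain" are interchangeable below, see
   [ergodicP]. *)
Definition ergodic (R : realType) (P : ptopologicalType)
    (N : normalization R P) (K : R.-pker (borel P) ~> (borel P))
    (a : nat -> scalars N) (b : nat -> offsets N)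
    (gamma : probability (borel P) R) : Prop :=
  forall mu : probability (borel P) R,
    exists d (Omega : measurableType d) (Pr : probability Omega R)
      (W : nat -> Omega -> borel P),
      markov_chain Pr mu K W /\
      cvg_in_distribution Pr (fun n w => normalize N (a n) (b n) (W n w)) gamma.

Section fluctuations.
Local Open Scope ereal_scope.
Context (R : realType) (P : topologicalType) (N : normalization R P).

Definition regular_fluctuations (a : nat -> scalars N) (b : nat -> offsets N)
    (f : R -> offsets N) (g : R -> scalars N) : Prop :=
  {ae lebesgue_measure, forall x : R, forall eps : nat -> R,
    eps =o_\oo (fun n => Num.sqrt n%:R) ->
    let m n := Num.truncn (n%:R + x * Num.sqrt n%:R + eps n)%R in
    sdilate (sinv (a n)) (b (m n) - b n)%R @[n --> \oo] --> f x /\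
    smul (a (m n)) (sinv (a n)) @[n --> \oo] --> g x}.

End fluctuations.

Section Theta.
Context (R : realType) (P : ptopologicalType) (N : normalization R P).
Context (a : scalars N) (b : offsets N).

Lemma normalize_continuous : continuous (normalize N a b).
Proof.
move=> x; rewrite /normalize.
apply: (@continuous_comp _ _ _ (fun y => (sinv a, translate y (- b)))
  (fun z => dilate z.1 z.2)); last exact: dilate_continuous.
apply: cvg_pair; first exact: cvg_cst.
apply: (@continuous_comp _ _ _ (fun y => (y, - b))
  (fun z => translate z.1 z.2)); last exact: translate_continuous.
by apply: cvg_pair; [exact: cvg_id|exact: cvg_cst].
Qed.

Lemma measurable_normalize :
  measurable_fun setT (normalize N a b : borel P -> borel P).
Proof.
apply: (@measurability _ _ (borel P) (borel P) setT (normalize N a b)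
  (@open P)) => // _ [U oU <-].
rewrite setTI; apply: sub_sigma_algebra.
by apply: open_comp oU => x _; exact: normalize_continuous.
Qed.

Context (mu : {finite_measure set (borel P) -> \bar R}).

Definition Theta : set (borel P) -> \bar R :=
  pushforward mu (normalize N a b : borel P -> borel P).

Let Theta0 : Theta set0 = 0%E.
Proof. by rewrite /Theta /pushforward preimage_set0 measure0. Qed.

Let Theta_ge0 A : (0 <= Theta A)%E.
Proof. exact: (@measure_ge0 _ _ _ mu). Qed.

Let Theta_sigma_additive : semi_sigma_additive Theta.
Proof.
by apply: (@measure_semi_sigma_additive _ _ _
  (pushforward mu (normalize N a b : borel P -> borel P)));
  exact: measurable_normalize.
Qed.

HB.instance Definition _ := isMeasure.Build _ _ _ Theta
  Theta0 Theta_ge0 Theta_sigma_additive.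

Let Theta_finite : fin_num_fun Theta.
Proof.
move=> A mA; apply: fin_num_measure.
by rewrite -[X in measurable X]setTI; exact: measurable_normalize.
Qed.

HB.instance Definition _ := Measure_isFinite.Build _ _ _ Theta Theta_finite.

End Theta.
Arguments Theta {R P} N a b mu.

Section limit_law.
Context (R : realType) (P : ptopologicalType) (pP : polish R P).
Context (N : normalization R P) (f : R -> offsets N) (g : R -> scalars N).
Hypotheses (mf : borel_measurable (f : measurableTypeR R -> offsets N)).
Hypotheses (mg : borel_measurable (g : measurableTypeR R -> scalars N)).

Definition limit_map (z : borel P * measurableTypeR R) : borel P :=
  translate (dilate (g z.2) z.1) (f z.2).

Lemma measurable_limit_map : measurable_fun setT limit_map.
Proof.
apply: (@measurability _ _ (borel P * measurableTypeR R)%type (borel P) setT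
  limit_map (@open P)) => // _ [U oU <-].
rewrite setTI.
have [BP cBP [oBP bP]] := polish_second_countable pP.
have [BV cBV [oBV bV]] := polish_second_countable (offsets_polish N).
have [BS cBS [oBS bS]] := polish_second_countable (scalars_polish N).
pose phi (z : (scalars N * P) * offsets N) := translate (dilate z.1.1 z.1.2) z.2.
have cphi : continuous phi.
  move=> z; apply: (@continuous_comp _ _ _ (fun z : (scalars N * P) * offsets N =>
    (dilate z.1.1 z.1.2, z.2)) (fun z => translate z.1 z.2));
    last exact: translate_continuous.
  apply: cvg_pair; last exact: cvg_snd.
  apply: (@continuous_comp _ _ _ fst (fun z => dilate z.1 z.2));
    [exact: cvg_fst|exact: dilate_continuous].
pose rect (B : set P * set (scalars N) * set (offsets N)) :=
  B.1.1 `*` (g @^-1` B.1.2 `&` f @^-1` B.2).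
pose I := [set B | (BP `*` BS `*` BV) B /\ rect B `<=` limit_map @^-1` U].
have -> : limit_map @^-1` U = \bigcup_(B in I) rect B.
  apply/seteqP; split=> [[x l] Uxl|z [B [_]]]; last by apply.
  have /cphi : nbhs (phi ((g l, x), f l)) U by exact: open_nbhs_nbhs.
  move=> [[A1 A2] /= [[[A11 A12] /= [A11g A12x] A1P] A2f] AU].
  have [B1 [bB1 B1x] sB1] := bP x _ A12x.
  have [B2 [bB2 B2g] sB2] := bS (g l) _ A11g.
  have [B3 [bB3 B3f] sB3] := bV (f l) _ A2f.
  exists ((B1, B2), B3) => //; split=> // -[y k] /= [B1y [B2y B3y]].
  by apply: (AU ((g k, y), f k)); split; [apply: A1P; split|] => /=;
    [exact: sB2|exact: sB1|exact: sB3].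
have cI : countable I.
  apply: (@sub_countable _ _ _ (BP `*` BS `*` BV)).
    by apply: subset_card_le => B [].
  by apply: countableX => //; exact: countableX.
have [->|/unsquash s] := pfcard_geP cI; first by rewrite bigcup_set0.
rewrite (reindex_bigcup s setT)//=.
apply: bigcupT_measurable => n.
have [[[BPs BSs] BVs] _] : I (s n) by exact: funS.
apply: measurableX; first by apply: sub_sigma_algebra; exact: oBP.
by apply: measurableI; [apply: mg|apply: mf];
  apply: sub_sigma_algebra; [exact: oBS|exact: oBV].
Qed.

(* The law of Gamma g(Lambda) + f(Lambda), for independent Gamma of law [gamma]
   and Lambda standard normal. *)
Definition limit_law (gamma : probability (borel P) R) :
    set (borel P) -> \bar R :=
  pushforward (gamma \x normal_prob 0 1)%E limit_map.

Context (gamma : probability (borel P) R).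

Let limit_law0 : limit_law gamma set0 = 0%E.
Proof. by rewrite /limit_law /pushforward preimage_set0 measure0. Qed.

Let limit_law_ge0 A : (0 <= limit_law gamma A)%E.
Proof. exact: (@measure_ge0 _ _ _ (gamma \x normal_prob 0 1)%E). Qed.

Let limit_law_sigma_additive : semi_sigma_additive (limit_law gamma).
Proof.
by apply: (@measure_semi_sigma_additive _ _ _
  (pushforward (gamma \x normal_prob 0 1)%E limit_map));
  exact: measurable_limit_map.
Qed.

HB.instance Definition _ := isMeasure.Build _ _ _ (limit_law gamma)
  limit_law0 limit_law_ge0 limit_law_sigma_additive.

Let limit_law_setT : limit_law gamma setT = 1%E.
Proof. by rewrite /limit_law /pushforward preimage_setT probability_setT. Qed.

HB.instance Definition _ :=
  Measure_isProbability.Build _ _ _ (limit_law gamma) limit_law_setT.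

Definition limit_measure : finite_measures R P := limit_law gamma.

End limit_law.

Section ergodicP.
Context (R : realType) (P : ptopologicalType).

Lemma markov_chain_law (mu : probability (borel P) R)
    (K : R.-pker (borel P) ~> (borel P))
    d (Omega : measurableType d) (Pr : probability Omega R) X
    d' (Omega' : measurableType d') (Pr' : probability Omega' R) X' :
  markov_chain Pr mu K X -> markov_chain Pr' mu K X' ->
  forall n A, measurable A -> Pr (X n @^-1` A) = Pr' (X' n @^-1` A).
Proof.
move=> [mX X0 XS] [mX2 X02 XS2]; elim=> [|n IH] A mA.
  by rewrite X0// X02.
have law e (O : measurableType e) (Q : probability O R) Y :
    (forall n, measurable_fun setT (Y n)) ->
    (forall n E A, history measurable Y n E -> measurable A ->
      Q (E `&` Y n.+1 @^-1` A) = (\int[Q]_(w in E) K (Y n w) A)%E) ->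
    Q (Y n.+1 @^-1` A) = (\int[pushforward Q (Y n)]_x K x A)%E.
  move=> mY YS; rewrite -[Y n.+1 @^-1` A]setTI YS//; last first.
    by apply: sub_sigma_algebra; exists n => //=; exists setT.
  rewrite ge0_integral_pushforward ?preimage_setT//.
  by apply: measurable_funTS; exact: measurable_kernel.
rewrite (law _ _ _ _ mX XS) (law _ _ _ _ mX2 XS2).
by apply: eq_measure_integral => B mB _; exact: IH.
Qed.

Lemma ergodicP (N : normalization R P) (K : R.-pker (borel P) ~> (borel P))
    (a : nat -> scalars N) (b : nat -> offsets N)
    (gamma : probability (borel P) R) :
  ergodic K a b gamma ->
  forall (mu : probability (borel P) R) d (Omega : measurableType d)
    (Pr : probability Omega R) (W : nat -> Omega -> borel P),
    markov_chain Pr mu K W ->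
    cvg_in_distribution Pr (fun n w => normalize N (a n) (b n) (W n w)) gamma.
Proof.
move=> erg mu d Omega Pr W mcW.
have [d2 [T2 [Pr2 [W2 [mcW2 cvW2]]]]] := erg mu.
move=> h; have := cvW2 h; apply: cvg_trans; apply: near_eq_cvg.
apply: nearW => n; have [ch [c hc]] := svalP h.
pose k : borel P -> R := fun x => sval h (normalize N (a n) (b n) x).
have ck : continuous (k : P -> R).
  by move=> x; apply: continuous_comp; [exact: normalize_continuous|exact: ch].
have mk : measurable_fun setT k.
  apply: (measurability _ (RGenOpens.measurableE R)) => _ [_ [x [y ->]] <-].
  rewrite setTI; apply: sub_sigma_algebra.
  by apply: open_comp (interval_open _ _) => // z _; exact: ck.
have E e (O : measurableType e) (Q : probability O R) Y :
    (forall n, measurable_fun setT (Y n)) ->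
    \int[Q]_w k (Y n w) = fine (\int[pushforward Q (Y n)]_x (k x)%:E)%E.
  move=> mY; rewrite /Rintegral integral_pushforward ?preimage_setT//.
    exact/measurable_EFinP.
  apply: (@measurable_bounded_integrable _ _ _ Q (k \o Y n)) => //.
  - by rewrite (le_lt_trans (probability_le1 _ _))// ltry.
  - exact: measurableT_comp.
  - exists c; split; first exact: num_real.
    by move=> z cz w _ /=; rewrite (le_trans (hc _))// ltW.
rewrite (E _ _ Pr2 W2 (markov_chain_measurable mcW2)).
rewrite (E _ _ Pr W (markov_chain_measurable mcW)); congr fine.
apply: eq_measure_integral => [||m1 m2 A mA _].
- exact: (markov_chain_measurable mcW n).
- exact: (markov_chain_measurable mcW2 n).
- exact: (markov_chain_law mcW2 mcW n mA).
Qed.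

End ergodicP.

(* Main.v *)
Require Import Defs.
From HB Require Import structures.
From mathcomp Require Import all_boot all_order all_algebra.
From mathcomp Require Import all_classical all_reals all_analysis.
From mathcomp Require Import measurable_realfun.
From mathcomp Require Import ring lra zify.

Set Implicit Arguments.
Unset Strict Implicit.
Unset Printing Implicit Defensive.

Import Order.TTheory GRing.Theory Num.Theory.
Import numFieldNormedType.Exports.

Local Open Scope classical_set_scope.
Local Open Scope ring_scope.

(** The urn evolves on the time scale [log n]: its composition at time [n] is
    approximately the law of the companion chain at the time
    [log n + Lambda * sqrt (log n)].

    Since every replacement has mass 1, the total mass at time [n] is
    deterministic, [total_mass M0 n = m + n]. Let [u_n] be the composition of the
    urn at time [n] tested against a function [phi] ([urn_mean]), and
    [p_n = 1 / (m + n + 1)]. The recursion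
    [u_(n+1) = (1 - p_n) u_n + p_n (K phi)(C_n)] shows that, given the past of
    time [n], the mean of [u_(n+1)] is the composition at time [n] tested against
    [(1 - p_n) phi + p_n K phi]. Iterating back to a time [j], the conditional
    mean of [u_n] is the composition at time [j] tested against
    [urn_back]: [phi] averaged along the companion chain run for a random number
    of steps, which is a sum of independent Bernoulli variables of parameters
    [p_j, ..., p_(n-1)].

    The martingale of these conditional means has orthogonal increments of size
    [O(p_i)], so that [u_n] is within [O(1 / j)] in mean square of its conditional
    mean given time [j], uniformly in [n] ([urn_mean_L2]). It thus suffices to
    find the limit of the deterministic functions [urn_back j (n - j) phi] for a
    fixed large [j], with [phi] the test function composed with the
    normalization at time [log n].

    By Le Cam's inequality the Bernoulli sum can be replaced by a Poisson
    variable of the same mean, with an error [O(1 / j)] ([urn_back_poisson]), and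
    that mean is [log n + O(1)] ([weight_sum_ln]). A Poisson variable of mean
    [lam] is [lam + Lambda * sqrt lam] with [Lambda] nearly normal. A local limit
    theorem is used in place of the central limit theorem
    ([cvg_poisson_density], dominated by [poisson_density_ub]): the limit is then
    only needed for almost every value of [Lambda] and no regularity in
    [Lambda] has to be known ([cvg_poisson_mean]). For a fixed value [y], the
    companion chain at time [k = log n + y sqrt (log n)], normalized for the time
    [k], converges by ergodicity, and the change of normalization from [k] to
    [log n] converges to the affine map of ratio [g y] and offset [f y] by the
    assumption on the fluctuations. An extended continuous mapping theorem
    ([cvg_integral_extended]) combines these two limits
    ([cvg_normalized_chain]).

    All this proves the convergence in mean square of the integral of each
    bounded continuous function ([cvg_urn_mean_L2]), hence in probability, and
    finitely many such functions determine a neighbourhood for the weak topology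
    ([cvg_in_probability_weak]). *)

(** * Bounded measurable functions *)

Section bounded_measurable.
Context d (T : measurableType d) (R : realType).
Implicit Types (phi psi : T -> R) (mu : {measure set T -> \bar R}).

Definition bounded_measurable phi : Prop :=
  measurable_fun setT phi /\ exists B, forall x, `|phi x| <= B.

Lemma bounded_measurable_cst c : bounded_measurable (fun=> c).
Proof. by split; [exact: measurable_cst|exists `|c|]. Qed.

Lemma bounded_measurable_indic A : measurable A -> bounded_measurable (\1_A).
Proof.
move=> mA; split; first exact: measurable_indic.
by exists 1 => x; rewrite indicE ger0_norm ?ler0n// lern1 leq_b1.
Qed.

Lemma bounded_measurableD phi psi : bounded_measurable phi ->
  bounded_measurable psi -> bounded_measurable (fun x => phi x + psi x).
Proof.
move=> [mf [B fB]] [mg [C gC]]; split; first exact: measurable_funD.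
by exists (B + C) => x; rewrite (le_trans (ler_normD _ _))// lerD.
Qed.

Lemma bounded_measurableM phi psi : bounded_measurable phi ->
  bounded_measurable psi -> bounded_measurable (fun x => phi x * psi x).
Proof.
move=> [mf [B fB]] [mg [C gC]]; split; first exact: measurable_funM.
by exists (B * C) => x; rewrite normrM ler_pM.
Qed.

Lemma bounded_measurableZ a phi : bounded_measurable phi ->
  bounded_measurable (fun x => a * phi x).
Proof.
by move=> bf; apply: (bounded_measurableM (bounded_measurable_cst a)).
Qed.

Lemma bounded_measurableB phi psi : bounded_measurable phi ->
  bounded_measurable psi -> bounded_measurable (fun x => phi x - psi x).
Proof.
move=> bf /(bounded_measurableZ (-1)) bg.
have := bounded_measurableD bf bg.
by congr bounded_measurable; apply/funext => x; rewrite mulN1r.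
Qed.

Lemma bounded_measurable_norm phi : bounded_measurable phi ->
  bounded_measurable (fun x => `|phi x|).
Proof.
move=> [mf [B fB]]; split; first exact: measurableT_comp.
by exists B => x; rewrite normr_id.
Qed.

Lemma bounded_measurable_comp d' (U : measurableType d') (X : U -> T) phi :
  measurable_fun setT X -> bounded_measurable phi ->
  measurable_fun setT (phi \o X) /\ exists B, forall u, `|phi (X u)| <= B.
Proof.
move=> mX [mf [B fB]]; split; first exact: measurableT_comp.
by exists B => u.
Qed.

Lemma bounded_measurable_integrable mu phi : (mu setT < +oo)%E ->
  bounded_measurable phi -> mu.-integrable setT (EFin \o phi).
Proof.
move=> muT [mf [B fB]]; apply: measurable_bounded_integrable => //.
exists B; split; first exact: num_real.
by move=> z Bz x _ /=; rewrite (le_trans (fB x))// ltW.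
Qed.

(** The layers [phi >= k / n] approximate [phi] within [1 / n], so that a class
    of functions stable under linear combinations and uniform limits is decided
    by its indicators. *)
Lemma bounded_measurable_ind (V : (T -> R) -> Prop) :
  (forall A, measurable A -> V (\1_A)) ->
  (forall a phi psi, V phi -> V psi -> V (fun x => a * phi x + psi x)) ->
  (forall (u : nat -> T -> R) phi, (forall n, V (u n)) ->
    (forall n x, `|u n x - phi x| <= n.+1%:R^-1) -> V phi) ->
  forall phi, bounded_measurable phi -> V phi.
Proof.
move=> V1 VD Vlim.
have V0 : V (fun=> 0).
  by have := V1 set0 measurable0; rewrite indic0.
suff H01 phi : measurable_fun setT phi -> (forall x, 0 <= phi x <= 1) -> V phi.
  move=> phi [mf [B fB]].
  pose C := `|B| + 1; have C0 : 0 < C by rewrite ltr_wpDl.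
  have fC x : `|phi x| <= C.
    by rewrite (le_trans (fB x))// (le_trans (ler_norm B))// lerDl.
  have V2 : V (fun x => (2 * C)^-1 * phi x + 2^-1).
    apply: H01 => [|x].
      by apply: measurable_funD => //; exact: measurable_funM.
    have := fC x; rewrite ler_norml => /andP[a b].
    have -> : (2 * C)^-1 * phi x + 2^-1 = (phi x + C) / (2 * C).
      by field; rewrite gt_eqF.
    apply/andP; split; first by apply: divr_ge0; lra.
    by rewrite ler_pdivrMr; lra.
  have VT : V (fun=> 1).
    by have := V1 setT measurableT; congr V; apply/funext => x; rewrite indicT.
  have := VD (2 * C) _ _ V2 (VD (- C) _ _ VT V0).
  by congr V; apply/funext => x; rewrite addr0; field; rewrite gt_eqF.
move=> mf f01.
pose A n k := [set x | k.+1%:R / n.+1%:R <= phi x].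
have mA n k : measurable (A n k).
  rewrite /A (_ : [set x | _] = phi @^-1` `[k.+1%:R / n.+1%:R, +oo[%classic).
    by rewrite -[_ @^-1` _]setTI; apply: mf.
  by apply/seteqP; split => x /=; rewrite in_itv/= andbT.
apply: (Vlim (fun n x => \sum_(k < n.+1) n.+1%:R^-1 * \1_(A n k) x)) => [n|n x].
  suff: forall N, V (fun x => \sum_(k < N) n.+1%:R^-1 * \1_(A n k) x) by apply.
  elim=> [|N IH]; first by under eq_fun do rewrite big_ord0.
  have := VD n.+1%:R^-1 _ _ (V1 _ (mA n N)) IH.
  by congr V; apply/funext => x; rewrite big_ord_recr /= addrC.
have sumE N t : (\sum_(k < N) (k < t)%N%:R : R) = (minn N t)%:R.
  elim: N => [|N IH]; first by rewrite big_ord0 min0n.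
  rewrite big_ord_recr /= IH -natrD; congr _%:R.
  by case: (ltnP N t) => Nt; rewrite /minn; repeat case: ifPn; lia.
set N := n.+1; have N0 : 0 < N%:R :> R by rewrite ltr0n.
have /andP[fx0 fx1] := f01 x.
have Nfx0 : 0 <= N%:R * phi x by exact: mulr_ge0.
rewrite -mulr_sumr (_ : \sum_(_ < _) _ = (Num.truncn (N%:R * phi x))%:R); last first.
  rewrite -[in RHS](minn_idPr (_ : (Num.truncn (N%:R * phi x) <= N)%N)); last first.
    rewrite truncn_le_nat (@le_lt_trans _ _ N%:R)// ?ltr_nat// ler_piMr//.
  rewrite -sumE; apply: eq_bigr => k _.
  rewrite indicE truncn_gt_nat mulrC -ler_pdivrMr//; congr (_%:R).
  by congr nat_of_bool; apply/idP/idP; [rewrite inE|move=> ?; rewrite inE].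
have /andP[a b] := truncn_itv Nfx0.
rewrite -(ler_pM2l N0) mulfV ?gt_eqF// -[X in X * _](gtr0_norm N0) -normrM.
rewrite mulrBr mulVKf ?gt_eqF//.
by rewrite ler_norml; move: a b; rewrite -natr1; set t := _%:R; lra.
Qed.

Lemma bounded_measurable_lim (u : nat -> T -> R) phi :
  (forall n, bounded_measurable (u n)) ->
  (forall n x, `|u n x - phi x| <= n.+1%:R^-1) -> bounded_measurable phi.
Proof.
move=> bu uphi; split.
  apply: (measurable_fun_cvg (h := u)) => [n|x _]; first by have [] := bu n.
  apply/cvgrPdist_le => e e0; near=> n.
  rewrite distrC (le_trans (uphi n x))// ltW//; near: n.
  exact: near_infty_natSinv_lt (PosNum e0).
have [_ [B uB]] := bu 0%N; exists (B + 1) => x.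
rewrite -[phi x](subKr (u 0%N x)) (le_trans (ler_normB _ _))// lerD//.
by rewrite (le_trans (uphi 0%N x))// invr1.
Unshelve. all: by end_near. Qed.

(** Linear forms that are continuous for the uniform norm, hence determined by
    their values at indicators. *)
Definition bounded_functional (L : (T -> R) -> R) : Prop :=
  (forall a phi psi, bounded_measurable phi -> bounded_measurable psi ->
    L (fun x => a * phi x + psi x) = a * L phi + L psi) /\
  exists c, forall B phi, bounded_measurable phi ->
    (forall x, `|phi x| <= B) -> `|L phi| <= c * B.

Lemma bounded_functionalZ L a phi : bounded_functional L ->
  bounded_measurable phi -> L (fun x => a * phi x) = a * L phi.
Proof.
move=> [D [c b]] bphi; have b0 := bounded_measurable_cst 0.
have L0 : L (fun=> 0) = 0.
  by apply/eqP; rewrite -normr_le0 -[leRHS](mulr0 c); apply: b => // x; rewrite normr0.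
rewrite -[RHS]addr0 -L0 -D//; congr L; apply/funext => x.
by rewrite addr0.
Qed.

Lemma bounded_functional_cvg L (u : nat -> T -> R) phi :
  bounded_functional L -> (forall n, bounded_measurable (u n)) ->
  bounded_measurable phi -> (forall n x, `|u n x - phi x| <= n.+1%:R^-1) ->
  L (u n) @[n --> \oo] --> L phi.
Proof.
move=> [D [c b]] bu bphi uphi.
have near_u n : `|L phi - L (u n)| <= c * n.+1%:R^-1.
  rewrite distrC (_ : L (u n) - L phi = L (fun x => (- 1) * phi x + u n x)).
    apply: b => [|x]; last by rewrite mulN1r addrC.
    by apply: bounded_measurableD => //; exact: bounded_measurableZ.
  by rewrite D// mulN1r addrC.
apply/cvgrPdist_le => e e0.
have /cvgrPdist_le/(_ _ e0) : c * harmonic n @[n --> \oo] --> c * 0.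
  by apply: cvgM; [exact: cvg_cst|exact: cvg_harmonic].
apply: filterS => n; rewrite mulr0 sub0r normrN; apply: le_trans.
by rewrite (le_trans (near_u n))// ler_norm.
Qed.

Lemma bounded_functional_eq (L1 L2 : (T -> R) -> R) :
  bounded_functional L1 -> bounded_functional L2 ->
  (forall A, measurable A -> L1 (\1_A) = L2 (\1_A)) ->
  forall phi, bounded_measurable phi -> L1 phi = L2 phi.
Proof.
move=> bL1 bL2 L12 phi bphi.
suff [] : bounded_measurable phi /\ L1 phi = L2 phi by [].
apply: (@bounded_measurable_ind (fun phi => bounded_measurable phi /\ L1 phi = L2 phi))
  => // {phi bphi} [A mA|a phi psi [bphi E1] [bpsi E2]|u phi uV uphi].
- by split; [exact: bounded_measurable_indic|exact: L12].
- split; first by apply: bounded_measurableD => //; exact: bounded_measurableZ.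
  by rewrite bL1.1// bL2.1// E1 E2.
have bphi := bounded_measurable_lim (fun n => (uV n).1) uphi.
split => //.
have bu n : bounded_measurable (u n) by have [] := uV n.
have cv1 := bounded_functional_cvg bL1 bu bphi uphi.
have cv2 := bounded_functional_cvg bL2 bu bphi uphi.
rewrite (_ : (fun n => L1 (u n)) = (fun n => L2 (u n))) in cv1.
  exact: cvg_unique cv1 cv2.
by apply/funext => n; exact: (uV n).2.
Qed.

Lemma bounded_functional_integral mu : (mu setT < +oo)%E ->
  bounded_functional (fun phi => \int[mu]_x phi x).
Proof.
move=> muT; split.
  move=> a phi psi bphi bpsi; have iphi := bounded_measurable_integrable muT bphi.
  rewrite RintegralD//; first by rewrite RintegralZl.
    apply: bounded_measurable_integrable => //; exact: bounded_measurableZ.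
  exact: bounded_measurable_integrable.
exists (fine (mu setT)) => B phi bphi phiB.
have iphi := bounded_measurable_integrable muT bphi.
rewrite (le_trans (le_normr_Rintegral _ iphi))// mulrC -Rintegral_cst//.
apply: le_Rintegral => //.
- exact/(bounded_measurable_integrable muT)/bounded_measurable_norm.
- exact/(bounded_measurable_integrable muT)/bounded_measurable_cst.
Qed.

End bounded_measurable.

Lemma measurable_integral_family d d' (X : measurableType d)
    (T : measurableType d') (R : realType) (k : X -> {measure set T -> \bar R})
    (phi : T -> R) :
  (forall x, (k x setT < +oo)%E) ->
  (forall A, measurable A -> measurable_fun setT (fun x => k x A)) ->
  bounded_measurable phi -> measurable_fun setT (fun x => \int[k x]_t phi t).
Proof.
move=> kT mk bphi.
have intk x := bounded_functional_integral (kT x).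
suff [] : bounded_measurable phi /\ measurable_fun setT (fun x => \int[k x]_t phi t)
  by [].
apply: (@bounded_measurable_ind _ _ _ (fun phi => bounded_measurable phi /\
    measurable_fun setT (fun x => \int[k x]_t phi t)))
  => // {phi bphi} [A mA|a phi psi [bphi E1] [bpsi E2]|u phi uV uphi].
- split; first exact: bounded_measurable_indic.
  under eq_fun do rewrite /Rintegral integral_indic// setIT.
  by apply: measurableT_comp => //; exact: mk.
- split; first by apply: bounded_measurableD => //; exact: bounded_measurableZ.
  under eq_fun => x do rewrite (intk x).1//.
  by apply: measurable_funD => //; exact: measurable_funM.
have bphi := bounded_measurable_lim (fun n => (uV n).1) uphi.
split=> //; apply: (measurable_fun_cvg (h := fun n x => \int[k x]_t u n t)).
  by move=> n; have [] := uV n.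
move=> x _; apply: (bounded_functional_cvg (intk x)) => // n.
by have [] := uV n.
Qed.

Lemma Rintegral_cst_probability d (T : measurableType d) (R : realType)
    (Pr : probability T R) (c : R) : \int[Pr]_x c = c.
Proof.
rewrite Rintegral_cst// [X in fine X](_ : _ = 1%E) ?mulr1//.
exact: probability_setT.
Qed.

Lemma probability_ltoo d (T : measurableType d) (R : realType)
    (Pr : probability T R) : (Pr setT < +oo)%E.
Proof. by apply: le_lt_trans (probability_le1 _ _) _; rewrite ?ltry. Qed.

(** * Poisson means *)

Section poisson_mean.
Context (R : realType).
Implicit Types (lam x p B : R) (c : nat -> R).

Definition poisson_weight lam k : R := expR (- lam) * (lam ^+ k / k`!%:R).

Definition poisson_mean lam c : R :=
  limn (series (fun k => poisson_weight lam k * c k)).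

Lemma poisson_weight_ge0 lam k : 0 <= lam -> 0 <= poisson_weight lam k.
Proof.
by move=> l0; rewrite mulr_ge0 ?expR_ge0// divr_ge0// exprn_ge0.
Qed.

Let egf c k := c k / k`!%:R.

Let is_cvg_egf c B x : (forall k, `|c k| <= B) -> cvgn (pseries (egf c) x).
Proof.
move=> cB; apply: normed_cvg; rewrite /normed_series_of /=.
have B0 : 0 <= B by rewrite (le_trans _ (cB 0%N)).
apply: (@series_le_cvg _ _ (B *: exp_coeff `|x|)) => // [k|k|].
- rewrite fctE /GRing.scale/= mulr_ge0// /exp_coeff/=.
  apply: divr_ge0; [exact: exprn_ge0|exact: ler0n].
- rewrite fctE /egf /exp_coeff/= !normrM normrX normfV (@ger0_norm _ k`!%:R)//.
  rewrite -mulrA [X in _ * X]mulrC; apply: ler_wpM2r (cB k).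
  by apply: divr_ge0; [exact: exprn_ge0|exact: ler0n].
- exact/is_cvg_seriesZ/is_cvg_series_exp_coeff.
Qed.

Let weightE lam c : (fun k => poisson_weight lam k * c k) =
  expR (- lam) *: (fun k => egf c k * lam ^+ k).
Proof.
apply/funext => k; rewrite fctE /= /poisson_weight /egf /GRing.scale/=.
by ring.
Qed.

Let poisson_meanE lam c B : (forall k, `|c k| <= B) ->
  poisson_mean lam c = expR (- lam) * limn (pseries (egf c) lam).
Proof. by move=> cB; rewrite /poisson_mean weightE (lim_seriesZ _ (is_cvg_egf cB)). Qed.

Lemma is_cvg_poisson_mean lam c B : (forall k, `|c k| <= B) ->
  cvgn (series (fun k => poisson_weight lam k * c k)).
Proof. by move=> cB; rewrite weightE; exact/is_cvg_seriesZ/(is_cvg_egf cB). Qed.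

Lemma poisson_mean_cst lam a : poisson_mean lam (fun=> a) = a.
Proof.
rewrite (@poisson_meanE _ _ `|a|)//.
rewrite (_ : pseries _ lam = series (a *: exp_coeff lam)).
  rewrite lim_seriesZ; last exact: is_cvg_series_exp_coeff.
  rewrite -[limn _]/(expR lam) /GRing.scale/= mulrCA mulrC expRN mulVf ?mul1r//.
  by rewrite expR_eq0.
rewrite /pseries; congr series; apply/funext => k; rewrite fctE /egf /exp_coeff /=.
by rewrite /GRing.scale/=; ring.
Qed.

Lemma poisson_meanD lam a c c' B B' :
  (forall k, `|c k| <= B) -> (forall k, `|c' k| <= B') ->
  poisson_mean lam (fun k => a * c k + c' k) =
  a * poisson_mean lam c + poisson_mean lam c'.
Proof.
move=> cB c'B; have cv := @is_cvg_poisson_mean lam c B cB.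
rewrite /poisson_mean -[X in X + _](lim_seriesZ a cv).
rewrite -lim_seriesD; [|exact: is_cvg_seriesZ|exact: (is_cvg_poisson_mean c'B)].
congr (limn (series _)); apply/funext => k; rewrite !fctE.
by rewrite /GRing.scale/=; ring.
Qed.

Lemma poisson_mean_le lam c B : 0 <= lam -> (forall k, `|c k| <= B) ->
  `|poisson_mean lam c| <= B.
Proof.
move=> l0 cB; have B0 : 0 <= B by rewrite (le_trans _ (cB 0%N)).
have le_mean c1 c2 : (forall k, `|c1 k| <= B) -> (forall k, `|c2 k| <= B) ->
    (forall k, c1 k <= c2 k) -> poisson_mean lam c1 <= poisson_mean lam c2.
  move=> b1 b2 c12; apply: lim_series_le.
  - exact: (is_cvg_poisson_mean b1).
  - exact: (is_cvg_poisson_mean b2).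
  - by move=> k; rewrite ler_wpM2l// poisson_weight_ge0.
rewrite ler_norml -{1}(poisson_mean_cst lam (- B)) -{2}(poisson_mean_cst lam B).
by apply/andP; split; apply: le_mean => // k; rewrite ?normrN ?ger0_norm//;
  have := cB k; rewrite ler_norml => /andP[].
Qed.

Lemma poisson_mean0 c B : (forall k, `|c k| <= B) -> poisson_mean 0 c = c 0%N.
Proof.
move=> cB; rewrite /poisson_mean; apply: lim_near_cst => //; near=> n.
have -> : n = n.-1.+1 by rewrite prednK//; near: n; exact: nbhs_infty_gt.
rewrite /series/= big_nat_recl// big1 ?addr0 => [|i _].
  by rewrite /poisson_weight oppr0 expR0 expr0 fact0; field.
by rewrite /poisson_weight expr0n /= mul0r mulr0 mul0r.
Unshelve. all: by end_near. Qed.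

Let is_derive_poisson_mean lam c B : (forall k, `|c k| <= B) ->
  is_derive lam 1 (poisson_mean ^~ c)
    (poisson_mean lam (fun k => c k.+1 - c k)).
Proof.
move=> cB; have c1B k : `|c k.+1| <= B by [].
have diffE f : pseries_diffs (egf f) = egf (f \o S).
  apply/funext => k; rewrite /pseries_diffs /egf factS natrM /=; field.
  by rewrite addrC natr1 !pnatr_eq0 -lt0n fact_gt0.
have -> : poisson_mean ^~ c =
    (fun x => expR (- x)) * (fun x => limn (pseries (egf c) x)).
  by apply/funext => x; rewrite (poisson_meanE _ cB).
have dE : is_derive lam 1 (fun x => limn (pseries (egf c) x))
    (limn (pseries (egf (c \o S)) lam)).
  rewrite -diffE; apply: (@pseries_snd_diffs _ _ (`|lam| + 1)).
  - exact: is_cvg_egf cB.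
  - by rewrite diffE; apply: (@is_cvg_egf _ B) => k; exact: cB.
  - by rewrite !diffE; apply: (@is_cvg_egf _ B) => k; exact: cB.
  - by rewrite [ltRHS]ger0_norm ?ltrDl// addr_ge0.
have -> : poisson_mean lam (fun k => c k.+1 - c k) =
    expR (- lam) *: limn (pseries (egf (c \o S)) lam)
    + limn (pseries (egf c) lam) *: (- expR (- lam)).
  rewrite (_ : (fun k => _) = (fun k => -1 * c k + c k.+1)); last first.
    by apply/funext => k; ring.
  rewrite (@poisson_meanD _ _ _ _ B B)// (poisson_meanE _ cB).
  by rewrite (@poisson_meanE _ _ B)// /GRing.scale/=; ring.
have dexpN : is_derive lam 1 (fun x : R => expR (- x)) (- expR (- lam)).
  have := @is_derive1_comp _ expR -%R lam (expR (- lam)) (-1) _ _.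
  by rewrite mulrN1; apply.
exact: is_deriveM.
Qed.

Let continuous_poisson_mean lam c B : (forall k, `|c k| <= B) ->
  {for lam, continuous (poisson_mean ^~ c)}.
Proof.
move=> cB; apply/differentiable_continuous/derivable1_diffP.
by have [] := @is_derive_poisson_mean lam c B cB.
Qed.

Let poisson_mean_increment lam p c B : 0 <= lam -> 0 <= p ->
  (forall k, `|c k| <= B) ->
  exists2 x, lam <= x <= lam + p & poisson_mean (lam + p) c - poisson_mean lam c =
    p * poisson_mean x (fun k => c k.+1 - c k).
Proof.
move=> l0 p0 cB.
have lp : lam <= lam + p by rewrite lerDl.
have drv x : x \in `]lam, lam + p[ -> is_derive x 1 (poisson_mean ^~ c)
  (poisson_mean x (fun k => c k.+1 - c k)) by move=> _; exact: is_derive_poisson_mean cB.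
have [|x xI E] := MVT_segment lp drv.
  by apply: continuous_subspaceT => x; exact: continuous_poisson_mean cB.
exists x; first by move: xI; rewrite in_itv.
by rewrite E addrAC subrr add0r mulrC.
Qed.

(** Le Cam's comparison of a Bernoulli step with a Poisson step: the left-hand
    side is the second order Taylor remainder of [poisson_mean ^~ c], whose
    derivative is [poisson_mean ^~ (fun k => c k.+1 - c k)]. *)
Lemma poisson_mean_le_cam lam p c B : 0 <= lam -> 0 <= p ->
  (forall k, `|c k| <= B) ->
  `|poisson_mean (lam + p) c
    - poisson_mean lam (fun k => (1 - p) * c k + p * c k.+1)| <= 4 * B * p ^+ 2.
Proof.
move=> l0 p0 cB; pose c1 k := c k.+1 - c k.
have c1B k : `|c1 k| <= 2 * B.
  by rewrite mulr_natl mulr2n (le_trans (ler_normB _ _))// lerD.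
have c2B k : `|c1 k.+1 - c1 k| <= 4 * B.
  rewrite (le_trans (ler_normB _ _))// (le_trans (lerD (c1B _) (c1B _)))//.
  by rewrite -mulrDl ler_wpM2r ?(le_trans _ (cB 0%N))//; lra.
have [x /andP[lx xp] E] := poisson_mean_increment l0 p0 cB.
have xl0 : 0 <= x - lam by rewrite subr_ge0.
have [y /andP[ly _]] := poisson_mean_increment l0 xl0 c1B.
rewrite [lam + (x - lam)]addrC subrK => E1.
rewrite (_ : (fun k => _) = (fun k => p * c1 k + c k)); last first.
  by apply/funext => k; rewrite /c1; ring.
rewrite (poisson_meanD _ _ c1B cB) opprD addrA addrAC E -mulrBr E1 !normrM.
rewrite (ger0_norm p0) (@ger0_norm _ (x - lam)) ?subr_ge0// expr2.
rewrite [leRHS]mulrC -!mulrA ler_wpM2l// ler_pM//.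
- by rewrite lerBlDl.
- exact: poisson_mean_le (le_trans l0 ly) c2B.
Qed.

End poisson_mean.

(** * Poisson local limit theorem *)

Section stirling.
Context (R : realType).
Implicit Types (lam mu u : R) (k n : nat).

(** Taylor's formula with a crude constant: the function being bounded has
    derivative [u ^+ 2 / (1 + u)]. *)
Lemma ln1D_taylor2 u : `|u| <= 2^-1 ->
  `|ln (1 + u) - u + u ^+ 2 / 2| <= 2 * `|u| ^+ 3.
Proof.
pose h : R -> R := (@ln R \o +%R 1) - id + 2^-1 \*: (id ^+ 2).
have hE x : h x = ln (1 + x) - x + x ^+ 2 / 2 by rewrite /h !fctE /GRing.scale/= mulrC.
have dh (x : R) : `|x| <= 2^-1 -> is_derive x 1 h (x ^+ 2 / (1 + x)).
  rewrite ler_norml => /andP[x1 x2]; have x0 : 0 < 1 + x by lra.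
  have dln : is_derive x 1 (@ln R \o +%R 1) (1 + x)^-1.
    have dD : is_derive x 1 (+%R 1 : R -> R) 1.
      have : is_derive x 1 (cst 1 + id : R -> R) (0 + 1) by exact: is_deriveD.
      by rewrite add0r.
    have := @is_derive1_comp _ (@ln R) (+%R 1) x (1 + x)^-1 1 (is_derive1_ln x0) dD.
    by rewrite mulr1.
  have did : is_derive x 1 (id : R -> R) 1 by exact: is_derive_id.
  apply: (is_derive_eq
    (is_deriveD (is_deriveB dln did) (is_deriveZ 2^-1 (is_deriveX 2 did)))).
  rewrite /GRing.scale/= expr1 mulr1.
  by field; rewrite gt_eqF.
have bnd a b : a <= b -> `|a| <= 2^-1 -> `|b| <= 2^-1 -> a = 0 \/ b = 0 ->
    `|h b - h a| <= 2 * (b - a) ^+ 3.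
  move=> ab a2 b2 ab0.
  have I x : a <= x <= b -> `|x| <= 2^-1 /\ `|x| <= b - a.
    move: a2 b2; rewrite !ler_norml => /andP[a2 _] /andP[_ b2] /andP[ax xb].
    by split; rewrite ?ler_norml; case: ab0 => ?; lra.
  have dI x : x \in `]a, b[ -> is_derive x 1 h (x ^+ 2 / (1 + x)).
    rewrite in_itv/= => /andP[ax xb]; apply: dh.
    by have [] := I x; rewrite ?(ltW ax) ?(ltW xb).
  have [|x xI ->] := MVT_segment ab dI.
    apply: derivable_within_continuous => x; rewrite in_itv/= => /I[x2 _].
    by have [] := dh x x2.
  have /I[x2 xb] : a <= x <= b by move: xI; rewrite in_itv.
  have x0 : 0 < 1 + x by move: x2; rewrite ler_norml => /andP[? ?]; lra.
  rewrite [(b - a) ^+ 3]exprSr [leRHS]mulrA normrM (ger0_norm (_ : 0 <= b - a)) ?subr_ge0//.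
  rewrite ler_wpM2r ?subr_ge0// normrM normfV (gtr0_norm x0) ler_pdivrMr//.
  rewrite normrX.
  have : `|x| ^+ 2 <= (b - a) ^+ 2 by rewrite lerXn2r// ?nnegrE ?subr_ge0.
  have := sqr_ge0 (b - a); move: x2; rewrite ler_norml => /andP[? ?].
  set p := (b - a) ^+ 2; set q := `|x| ^+ 2; nra.
have h0 : h 0 = 0 by rewrite hE addr0 ln1 expr0n/= mul0r addr0 subr0.
have z2 : `|0 : R| <= 2^-1 by rewrite normr0 invr_ge0.
move=> u2; rewrite -hE; have [u0|u0] := leP 0 u.
  by have := bnd _ _ u0 z2 u2 (or_introl erefl); rewrite h0 !subr0 (ger0_norm u0).
have := bnd _ _ (ltW u0) u2 z2 (or_intror erefl).
by rewrite h0 sub0r normrN sub0r (ltr0_norm u0).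
Qed.

(** By Stirling's formula, [stirling k] tends to the logarithm of the square
    root of [2 * pi]. Only its convergence is proved here: the limit is
    identified later, by integrating a local limit theorem. *)
Definition stirling k : R := ln k`!%:R - (k%:R + 2^-1) * ln k%:R + k%:R.

Let stirling_step k : (2 <= k)%N ->
  `|stirling k.+1 - stirling k| <= 8 * (k%:R^-1 - k.+1%:R^-1).
Proof.
move=> k2; have k0 : 0 < k%:R :> R by rewrite ltr0n (leq_trans _ k2).
have k2R : 2 <= k%:R :> R by rewrite ler_nat.
pose x : R := k%:R^-1.
have x0 : 0 < x by rewrite invr_gt0.
have x2 : x <= 2^-1 by rewrite lef_pV2 ?posrE.
have := @ln1D_taylor2 x; rewrite (gtr0_norm x0) => /(_ x2).
rewrite /stirling factS natrM lnM ?posrE ?ltr0n ?fact_gt0//.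
have -> : ln k.+1%:R = ln k%:R + ln (1 + x).
  rewrite -lnM ?posrE ?addr_gt0// mulrDr mulr1 mulfV ?gt_eqF//.
  by rewrite natr1.
rewrite -(@natr1 _ k); set l := ln (1 + x); set r := l - x + x ^+ 2 / 2.
have lE : l = r + x - x ^+ 2 / 2 by rewrite /r; ring.
have kx : k%:R * x = 1 by rewrite mulfV ?gt_eqF.
move=> rx; set m := ln k%:R; set f := ln _.
have -> : m + l + f - (k%:R + 1 + 2^-1) * (m + l) + (k%:R + 1)
    - (f - (k%:R + 2^-1) * m + k%:R) = x ^+ 2 / 4 - (k%:R + 2^-1) * r.
  rewrite lE; rewrite (_ : x ^+ 2 = x * x)//.
  transitivity (1 - (k%:R * x) + (k%:R * x) * x / 2 - x / 2 + x * x / 4 - (k%:R + 2^-1) * r).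
    by field.
  by rewrite kx; field.
have -> : k%:R^-1 - (k%:R + 1)^-1 = x ^+ 2 / (1 + x).
  by rewrite /x; field; rewrite !gt_eqF ?addr_gt0.
have kr : `|(k%:R + 2^-1) * r| <= 2 * x ^+ 2 + x ^+ 3.
  have k2_ge0 : 0 <= k%:R + 2^-1 :> R by rewrite addr_ge0.
  rewrite normrM ger0_norm// (le_trans (ler_wpM2l k2_ge0 rx))//.
  rewrite le_eqVlt; apply/orP; left; apply/eqP.
  transitivity (2 * (k%:R * x) * x ^+ 2 + x ^+ 3); first by field.
  by rewrite kx mulr1.
rewrite mulrA ler_pdivlMr ?addr_gt0//; set w := _ * r in kr *.
have x20 : 0 <= x ^+ 2 by exact: sqr_ge0.
have x32 : x ^+ 3 <= x ^+ 2 / 2 by rewrite exprSr ler_wpM2l.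
have w3 : `|x ^+ 2 / 4 - w| <= 3 * x ^+ 2.
  by move: kr; rewrite !ler_norml => /andP[? ?]; lra.
by have := normr_ge0 (x ^+ 2 / 4 - w); nra.
Qed.

Lemma stirling_is_cvg : cvgn stirling.
Proof.
pose v n : R := 8 * n.+2%:R^-1.
pose w n := stirling n.+2 + v n.
have step n : `|stirling n.+3 - stirling n.+2| <= v n - v n.+1.
  by rewrite /v -mulrBr; exact: stirling_step.
have w_dec : nonincreasing_seq w.
  apply/nonincreasing_seqP => n; have := step n.
  by rewrite /w ler_norml => /andP[? ?]; lra.
have w_inc : nondecreasing_seq (fun n => stirling n.+2 - v n).
  apply/nondecreasing_seqP => n; have := step n.
  by rewrite /w ler_norml => /andP[? ?]; lra.
have cw : cvgn w.
  apply: nonincreasing_is_cvgn => //; exists (stirling 2 - v 0%N) => _ [n _ <-].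
  rewrite (le_trans (w_inc 0%N n _))// /w lerD2l.
  have : 0 <= v n by rewrite mulr_ge0// invr_ge0.
  by lra.
have cv : v n @[n --> \oo] --> 0.
  rewrite -(mulr0 8); apply: cvgM; first exact: cvg_cst.
  have := @cvg_harmonic R; rewrite -(@cvg_shiftS _ (@harmonic R)).
  exact.
have : cvgn (fun n => w n - v n).
  by apply: is_cvgB => //; apply/cvg_ex; exists 0.
rewrite (_ : (fun n => _) = (fun n => stirling (n + 2))).
  by move=> /cvg_ex[l]; rewrite cvg_shiftn => sl; apply/cvg_ex; exists l.
by apply/funext => n; rewrite /w addrK addn2.
Qed.

Lemma stirling_lbound : exists c, forall k, c <= stirling k.
Proof.
have [B [_ sB]] := cvg_seq_bounded stirling_is_cvg.
exists (- (B + 1)) => k; have : `|stirling k| <= B + 1.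
  by apply: sB; rewrite ?ltrDl.
by rewrite ler_norml => /andP[].
Qed.

(** Stirling's approximation of the Poisson weights: the last summand is
    asymptotic to [- (lam - k) ^+ 2 / (2 * k)] when [k] is close to [lam]. *)
Lemma poisson_weightE lam k : 0 < lam -> (0 < k)%N ->
  poisson_weight lam k = expR (- stirling k - ln k%:R / 2
    + k%:R * (ln (1 + (lam - k%:R) / k%:R) - (lam - k%:R) / k%:R)).
Proof.
move=> l0 k0; have kR : 0 < k%:R :> R by rewrite ltr0n.
have -> : 1 + (lam - k%:R) / k%:R = lam / k%:R by field; rewrite gt_eqF.
rewrite ln_div ?posrE// /poisson_weight.
rewrite -(@lnK _ (lam ^+ k / k`!%:R)) ?posrE ?divr_gt0 ?exprn_gt0 ?ltr0n ?fact_gt0//.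
rewrite -expRD ln_div ?posrE ?exprn_gt0 ?ltr0n ?fact_gt0// lnXn//.
congr expR; rewrite /stirling -mulr_natl; field.
by rewrite gt_eqF.
Qed.

(** In [poisson_weightE], [stirling] is bounded below and the last summand is
    nonpositive. *)
Lemma poisson_weight_ub : exists2 B, 0 < B & forall lam k, 0 < lam ->
  poisson_weight lam k <= B /\ Num.sqrt k%:R * poisson_weight lam k <= B.
Proof.
have [c cS] := stirling_lbound.
exists (1 + expR (- c)); first by rewrite ltr_wpDr// expR_ge0.
move=> lam [|k] l0.
  rewrite sqrtr0 mul0r /poisson_weight expr0 fact0 divr1 mulr1.
  split; last by rewrite addr_ge0 ?expR_ge0.
  by rewrite -[leLHS]addr0 lerD ?expR_ge0// -expR0 ler_expR oppr_le0 ltW.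
set K := k.+1; have K0 : 0 < K%:R :> R by rewrite ltr0n.
have bnd : Num.sqrt K%:R * poisson_weight lam K <= 1 + expR (- c).
  rewrite -[leLHS]add0r lerD// poisson_weightE//.
  rewrite -[Num.sqrt _]lnK ?posrE ?sqrtr_gt0// -expRD ler_expR.
  have -> : ln (Num.sqrt K%:R) = ln K%:R / 2 :> R.
    by rewrite -powR12_sqrt ?ltW// ln_powR mulrC.
  have u1 : -1 < (lam - K%:R) / K%:R.
    by rewrite mulrBl mulfV ?gt_eqF// ltrBrDr addNr divr_gt0.
  have := le_ln1Dx u1; have := cS K.
  set u := _ / K%:R; set L := ln (1 + u) => cK Lu.
  have : K%:R * (L - u) <= 0 by rewrite mulr_ge0_le0 ?subr_le0// ltW.
  lra.
split=> //; apply: le_trans bnd; apply: ler_peMl.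
  by apply: poisson_weight_ge0; exact: ltW.
by rewrite -[leLHS]sqrtr1 ler_wsqrtr// ler1n.
Qed.

End stirling.

Section poisson_local_limit.
Context (R : realType).
Implicit Types (lam mu u : R) (k n : nat).

(** The times occurring in [regular_fluctuations], without perturbation; [y] is
    the standardization of a Poisson variable of mean close to [L]. *)
Definition rounding (L : nat) (y : R) : nat :=
  Num.truncn (L%:R + y * Num.sqrt L%:R).

(** The density of the standardization of a Poisson variable, smeared over the
    cells of [rounding]; its integrals are the Poisson means. *)
Definition poisson_density lam (L : nat) (y : R) : R :=
  if - Num.sqrt L%:R <= y
  then Num.sqrt L%:R * poisson_weight lam (rounding L y) else 0.

Lemma poisson_density_ge0 lam L y : 0 <= lam -> 0 <= poisson_density lam L y.
Proof.
move=> l0; rewrite /poisson_density; case: ifP => // _.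
by apply: mulr_ge0 => //; exact: poisson_weight_ge0.
Qed.

Lemma rounding_bounds (L : nat) (y : R) : - Num.sqrt L%:R <= y ->
  (rounding L y)%:R <= L%:R + y * Num.sqrt L%:R < (rounding L y)%:R + 1.
Proof.
move=> yL; rewrite natr1; apply: truncn_itv.
rewrite -[X in X + _]sqr_sqrtr// expr2 -mulrDl mulr_ge0//.
by rewrite addrC -lerBlDr sub0r.
Qed.

Let expR_le s : `|s| <= 2^-1 -> expR s - 1 <= s + 2 * s ^+ 2 :> R.
Proof.
rewrite ler_norml => /andP[s1 s2]; have s3 : 0 < 1 - s by lra.
have : 1 - s <= expR (- s) by exact: expR_ge1Dx.
rewrite expRN -(ler_pM2r (expR_gt0 s)) mulVf ?expR_eq0// => es.
rewrite -(ler_pM2l s3); rewrite expr2.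
have : 0 <= s * s * (1 - 2 * s).
  by rewrite -expr2 mulr_ge0 ?sqr_ge0// subr_ge0; lra.
have -> : (1 - s) * (s + 2 * (s * s)) = s + s * s * (1 - 2 * s) by ring.
by rewrite mulrBr mulr1; lra.
Qed.

(** Exponential tilting [lam] into [lam * expR s], with [s] equal to 2 over
    [sqrt L] up to the sign of [y], trades the uniform bound on the weights for
    an exponential decay in [y]. *)
Lemma poisson_density_ub c : exists B, forall lam L y,
  0 < lam -> (16 <= L)%N -> `|lam - L%:R| <= c ->
  poisson_density lam L y <= B * expR (- `|y|).
Proof.
have [B B0 wB] := @poisson_weight_ub R.
exists (2 * B * expR (9 * (1 + c))) => lam L y l0 L16 lL.
have c0 : 0 <= c by exact: le_trans (normr_ge0 _) lL.
have L16R : 16 <= L%:R :> R by rewrite (ler_nat _ 16).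
rewrite /poisson_density; case: ifPn => [yL|_]; last first.
  by rewrite !mulr_ge0 ?expR_ge0// ltW.
set rho := Num.sqrt L%:R in yL *; set k := rounding L y.
have rho2 : rho ^+ 2 = L%:R by rewrite sqr_sqrtr.
have rho_ge0 : 0 <= rho by exact: sqrtr_ge0.
have rho4 : 4 <= rho.
  by rewrite -(@ler_pXn2r _ 2) ?nnegrE// rho2; lra.
have [k1 k2] := andP (rounding_bounds yL); rewrite -/rho -/k in k1 k2.
pose sg : R := if 0 <= y then 1 else -1.
have sgy : sg * y = `|y|.
  by rewrite /sg; have [y0|y0] := leP 0 y; rewrite ?mul1r ?mulN1r
    ?(ger0_norm y0) ?(ltr0_norm y0).
have sg1 : `|sg| = 1 by rewrite /sg; case: ifP; rewrite ?normrN normr1.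
pose s := sg * (2 / rho).
have rho_gt0 : 0 < rho by lra.
have ns : `|s| = 2 / rho by rewrite /s normrM sg1 mul1r gtr0_norm// divr_gt0.
have s2 : `|s| <= 2^-1 by rewrite ns ler_pdivrMr//; lra.
have srho : s * rho = 2 * sg by rewrite /s; field; rewrite gt_eqF.
pose mu := lam * expR s.
have mu0 : 0 < mu by rewrite mulr_gt0 ?expR_gt0.
have tilt : poisson_weight lam k =
    poisson_weight mu k * expR (lam * (expR s - 1) - s * k%:R).
  rewrite /poisson_weight /mu exprMn -expRM_natr.
  rewrite (_ : - lam = - (lam * expR s) + s * k%:R + (lam * (expR s - 1) - s * k%:R)).
    by rewrite [in LHS]expRD [in LHS]expRD; ring.
  by ring.
have expo : lam * (expR s - 1) - s * k%:R <= 9 * (1 + c) - 2 * `|y|.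
  have h1 : lam * (expR s - 1) <= lam * (s + 2 * s ^+ 2).
    by apply: ler_wpM2l; [exact: ltW|exact: expR_le].
  have h2 : lam * s ^+ 2 <= 4 * (1 + c).
    have -> : s ^+ 2 = 4 / L%:R.
      rewrite -real_normK ?num_real// ns -rho2; field.
      by rewrite gt_eqF.
    rewrite mulrCA ler_wpM2l// ler_pdivrMr; last by lra.
    have : c <= c * L%:R by rewrite ler_peMr//; lra.
    by move: lL; rewrite ler_norml => /andP[_ ?]; lra.
  have h3 : s * (lam - L%:R) <= c.
    rewrite (le_trans (ler_norm _))// normrM -[leRHS]mul1r ler_pM//.
    by rewrite (le_trans s2)//; lra.
  have h4 : s * (L%:R + y * rho - k%:R) <= 1.
    rewrite (le_trans (ler_norm _))// normrM -[leRHS]mul1r ler_pM//.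
      by rewrite (le_trans s2)//; lra.
    by rewrite ler_norml; lra.
  have h5 : s * (y * rho) = 2 * `|y|.
    rewrite (_ : s * (y * rho) = s * rho * y); first by rewrite srho -sgy; ring.
    by ring.
  have -> : lam * (expR s - 1) - s * k%:R = lam * (expR s - 1) - lam * s
     + (s * (lam - L%:R) + s * (L%:R + y * rho - k%:R) - s * (y * rho)) by ring.
  rewrite h5; lra.
rewrite tilt mulrA.
have wmu : rho * poisson_weight mu k <= 2 * B * expR `|y|.
  have [w1 w2] := wB mu k mu0; have w0 := poisson_weight_ge0 k (ltW mu0).
  have e1 : 1 + `|y| <= expR `|y| by exact: expR_ge1Dx.
  have [y2|y2] := leP (- (rho / 2)) y.
    have rk : rho <= 2 * Num.sqrt k%:R.
      rewrite -(@ler_pXn2r _ 2) ?nnegrE ?mulr_ge0// rho2 exprMn sqr_sqrtr//.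
      have : - (rho / 2) * rho <= y * rho by rewrite ler_wpM2r.
      by rewrite mulNr mulrAC -expr2 rho2; lra.
    have : rho * poisson_weight mu k <= 2 * Num.sqrt k%:R * poisson_weight mu k.
      by rewrite ler_wpM2r.
    move=> /le_trans; apply; rewrite -mulrA -[leRHS]mulrA ler_wpM2l//.
    rewrite (le_trans w2)// ler_peMr ?(ltW B0)// (le_trans _ e1)//.
    by rewrite lerDl.
  have : rho <= 2 * expR `|y|.
    by have := ler_norm (- y); rewrite normrN; lra.
  by move=> h; rewrite mulrAC; apply: ler_pM.
have -> : 2 * B * expR (9 * (1 + c)) * expR (- `|y|) =
    (2 * B * expR `|y|) * expR (9 * (1 + c) - 2 * `|y|).
  by rewrite -!mulrA -!expRD; congr (_ * (_ * expR _)); ring.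
apply: ler_pM => //.
- by apply: mulr_ge0 => //; apply: poisson_weight_ge0; exact: ltW.
- by rewrite ler_expR.
Qed.

(** At [k = rounding (L n) y] the last summand of [poisson_weightE] is
    [- a n ^+ 2 * b n / 2] up to a cubic error, where [a n] tends to [- y] and
    [b n] to 1. The constant, the exponential of minus the limit of [stirling],
    is identified in [cvg_poisson_mean]. *)
Lemma cvg_poisson_density : exists C : R, forall (c : R) (lam : nat -> R) (L : nat -> nat),
  (forall n, 0 < lam n) -> (forall n, `|lam n - (L n)%:R| <= c) ->
  (L n)%:R @[n --> \oo] --> (+oo : set_system R) ->
  forall y, poisson_density (lam n) (L n) y @[n --> \oo] -->
    C * expR (- (y ^+ 2 / 2)).
Proof.
have /cvg_ex[sigma stirling_sigma] := @stirling_is_cvg R.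
exists (expR (- sigma)) => c lam L l0 lL Loo y.
rewrite -expRD.
pose rho n : R := Num.sqrt (L n)%:R.
have rho2 n : rho n ^+ 2 = (L n)%:R by rewrite sqr_sqrtr.
have rho_oo : rho n @[n --> \oo] --> (+oo : set_system R).
  apply/cvgryPge => A; move/cvgryPge : Loo => /(_ (A ^+ 2)).
  apply: filterS => n An; rewrite (le_trans (ler_norm A))// -sqrtr_sqr.
  by rewrite ler_wsqrtr.
have iv0 : (rho n)^-1 @[n --> \oo] --> 0.
  apply/gtr0_cvgV0 => //; exact: cvgry_gt.
pose k n := rounding (L n) y.
pose r n := (L n)%:R + y * rho n - (k n)%:R.
have yrho : \forall n \near \oo, - rho n <= y.
  have /cvgryPge/(_ (- y)) := rho_oo; apply: filterS => n.
  by rewrite lerNl.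
have r01 : \forall n \near \oo, 0 <= r n <= 1.
  move: yrho; apply: filterS => n /rounding_bounds/andP[].
  by rewrite -/(rho n) -/(k n) /r => ? ?; apply/andP; split; lra.
have small (u v : nat -> R) : (\forall n \near \oo, `|u n| <= v n) ->
    v n @[n --> \oo] --> 0 -> u n @[n --> \oo] --> 0.
  move=> uv v0; apply/cvgr0Pnorm_le => e e0.
  move/cvgr0Pnorm_le : v0 => /(_ e e0).
  by apply: filterS2 uv => n /le_trans uv /(le_trans (ler_norm _)); exact: uv.
have riv : r n * (rho n)^-1 @[n --> \oo] --> 0.
  apply: (small _ (fun n => `|(rho n)^-1|)).
    move: r01; apply: filterS => n /andP[r0 r1].
    by rewrite normrM ler_piMl// ger0_norm.
  by rewrite -(normr0 R); exact: cvg_norm.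
have lLiv : (lam n - (L n)%:R) * (rho n)^-1 @[n --> \oo] --> 0.
  apply: (small _ (fun n => c * `|(rho n)^-1|)).
    by apply: nearW => n; rewrite normrM ler_wpM2r.
  rewrite -(mulr0 c) -(normr0 R); apply: cvgM; [exact: cvg_cst|exact: cvg_norm].
pose a n := (lam n - (k n)%:R) * (rho n)^-1.
have rho_gt0 : \forall n \near \oo, 0 < rho n by exact: cvgry_gt.
have cva : a n @[n --> \oo] --> - y.
  pose proof (cvgD (cvgB lLiv (cvg_cst y)) riv) as H; rewrite sub0r addr0 in H.
  apply: (cvg_trans _ H); apply: near_eq_cvg; move: rho_gt0; apply: filterS => n rn.
  by rewrite !fctE /a /r; field; rewrite gt_eqF.
pose b n : R := (L n)%:R / (k n)%:R.
have cvbV : (k n)%:R / (L n)%:R @[n --> \oo] --> (1 : R).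
  pose proof (cvgB (cvgD (cvg_cst (1 : R)) (cvgM (cvg_cst y) iv0)) (cvgM riv iv0)) as H.
  rewrite !mulr0 addr0 subr0 in H.
  apply: (cvg_trans _ H); apply: near_eq_cvg; move: rho_gt0; apply: filterS => n rn.
  by rewrite !fctE/= /r -!rho2; field; rewrite gt_eqF.
have cvb : b n @[n --> \oo] --> (1 : R).
  rewrite -invr1 (_ : b = fun n => ((k n)%:R / (L n)%:R)^-1); last first.
    by apply/funext => n; rewrite invf_div.
  by apply: cvgV => //; rewrite oner_neq0.
have K0 : \forall n \near \oo, (0 < k n)%N.
  near=> n; have : 0 < (k n)%:R / (L n)%:R :> R.
    by near: n; apply: cvgr_gt cvbV _ _; exact: ltr01.
  by case: (k n) => //; rewrite mul0r ltxx.
have k_oo : (k n) @[n --> \oo] --> \oo.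
  apply/cvgnyPge => M; near=> n.
  have h1 : 2^-1 <= (k n)%:R / (L n)%:R :> R.
    by near: n; apply: cvgr_ge cvbV _ _; rewrite invf_lt1//; lra.
  have h2 : 2 * M%:R + 1 <= (L n)%:R :> R by near: n; exact: cvgry_ge.
  have M0 : 0 <= M%:R :> R by [].
  rewrite -(ler_nat R); move: h1; rewrite ler_pdivlMr; lra.
pose u n := (lam n - (k n)%:R) / (k n)%:R.
have kR0 : \forall n \near \oo, (k n)%:R != 0 :> R.
  by move: K0; apply: filterS => n; rewrite pnatr_eq0 lt0n.
have cvu : u n @[n --> \oo] --> 0.
  pose proof (cvgM (cvgM cva iv0) cvb) as H; rewrite mulr0 mul0r in H.
  apply: (cvg_trans _ H); apply: near_eq_cvg; apply: filterS2 kR0 rho_gt0 => n Kn rn.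
  by rewrite ?fctE/= /u /a /b -!rho2; field; rewrite Kn gt_eqF.
pose q n := a n ^+ 2 * b n.
have cvq : q n @[n --> \oo] --> y ^+ 2.
  pose proof (cvgM (cvgM cva cva) cvb) as H.
  by rewrite mulr1 mulrNN in H.
pose del n := (k n)%:R * (ln (1 + u n) - u n) + q n / 2.
have qE : \forall n \near \oo, q n = (k n)%:R * u n ^+ 2.
  apply: filterS2 kR0 rho_gt0 => n Kn rn.
  by rewrite /q /u /a /b -rho2; field; rewrite Kn gt_eqF.
have cvdel : del n @[n --> \oo] --> 0.
  apply: (small _ (fun n => 2 * q n * `|u n|)); last first.
    rewrite -(mulr0 (2 * y ^+ 2)) -(normr0 R); apply: cvgM; last exact: cvg_norm.
    by apply: cvgM => //; exact: cvg_cst.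
  near=> n; have u2 : `|u n| <= 2^-1.
    by near: n; move/cvgr0Pnorm_le : cvu; apply; rewrite invr_gt0.
  have qn : q n = (k n)%:R * u n ^+ 2 by near: n.
  rewrite /del qn (_ : _ + _ = (k n)%:R * (ln (1 + u n) - u n + u n ^+ 2 / 2)); last first.
    by ring.
  rewrite normrM ger0_norm//.
  have -> : 2 * ((k n)%:R * u n ^+ 2) * `|u n| = (k n)%:R * (2 * `|u n| ^+ 3).
    by rewrite (exprS _ 2) real_normK ?num_real//; ring.
  by rewrite ler_wpM2l// ln1D_taylor2.
apply: (@cvg_trans _ (expR (ln (b n) / 2 - stirling R (k n) - q n / 2 + del n)
   @[n --> \oo])).
  apply: near_eq_cvg; near=> n.
  have rn : 0 < rho n by near: n.
  have kn : (0 < k n)%N by near: n.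
  have yn : - rho n <= y by near: n.
  rewrite /poisson_density -/(rho n) yn -/(k n) poisson_weightE//.
  have Ln : 0 < (L n)%:R :> R by rewrite -rho2 exprn_gt0.
  have Kn : 0 < (k n)%:R :> R by rewrite ltr0n.
  rewrite /del /b ln_div ?posrE// -rho2 lnXn//.
  rewrite -[X in _ = X * _](@lnK _ (rho n))// -expRD; congr expR.
  by rewrite /u mulr2n; field; rewrite gt_eqF.
apply: (cvg_comp _ expR); last exact: continuous_expR.
have cvln : ln (b n) @[n --> \oo] --> (0 : R).
  have := @continuous_ln R 1 ltr01; rewrite /prop_for /continuous_at ln1.
  exact: cvg_comp cvb.
have cvs : stirling R (k n) @[n --> \oo] --> sigma by exact: cvg_comp k_oo stirling_sigma.
pose proof (cvgD (cvgB (cvgB (cvgM cvln (cvg_cst (2^-1 : R))) cvs) (cvgM cvq (cvg_cst (2^-1 : R)))) cvdel) as H.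
by rewrite mul0r sub0r addr0 in H.
Unshelve. all: by end_near. Qed.

(** Functions of [rounding L y] integrate to sums, cell by cell. *)
Section smearing.
Variables (L : nat) (v : nat -> R).
Hypothesis L_gt0 : (0 < L)%N.

Definition smear (y : R) : R :=
  if - Num.sqrt L%:R <= y then v (rounding L y) else 0.

Let rho : R := Num.sqrt L%:R.
Let rho_gt0 : 0 < rho. Proof. by rewrite sqrtr_gt0 ltr0n. Qed.
Let rho2 : rho ^+ 2 = L%:R. Proof. by rewrite sqr_sqrtr. Qed.

Let cell k : set R := `[(k%:R - L%:R) / rho, (k.+1%:R - L%:R) / rho[%classic.

Let cell_rounding k y : cell k y -> - rho <= y /\ rounding L y = k.
Proof.
rewrite /cell /= in_itv/= ler_pdivrMr// ltr_pdivlMr// => /andP[y1 y2].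
have Lrho : - rho * rho = - L%:R by rewrite mulNr -expr2 rho2.
split.
  by rewrite -(ler_pM2r rho_gt0) Lrho (le_trans _ y1)// lerBrDr addNr.
by apply: truncn_def; rewrite -/rho; apply/andP; split; lra.
Qed.

Let cell_cover y : - rho <= y -> cell (rounding L y) y.
Proof.
move=> /rounding_bounds/andP[y1 y2]; rewrite -/rho natr1 in y1 y2.
by rewrite /cell /= in_itv/= ler_pdivrMr// ltr_pdivlMr//; apply/andP; split; lra.
Qed.

Let smear_cell k : {in cell k, smear =1 cst (v k)}.
Proof. by move=> y /set_mem/cell_rounding[yL yk]; rewrite /smear yL yk. Qed.

Let smear_restrict : smear = smear \_ (\bigcup_k cell k).
Proof.
apply/funext => y; rewrite patchE; case: ifPn => // /negP yN.
rewrite /smear; case: ifPn => // yL; exfalso; apply: yN; apply/mem_set.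
by exists (rounding L y) => //; exact: cell_cover.
Qed.

Let mcell k : measurable (cell k). Proof. exact: measurable_itv. Qed.

Let measurable_smear_cells : measurable_fun (\bigcup_k cell k) smear.
Proof.
apply/measurable_fun_bigcup => // k.
by apply: (eq_measurable_fun (cst (v k))) => // y yk; rewrite (smear_cell yk).
Qed.

Lemma measurable_smear : measurable_fun setT smear.
Proof.
rewrite smear_restrict; apply/(measurable_restrictT _ _).1 => //.
exact: bigcup_measurable.
Qed.

Lemma integral_smear : (forall k, 0 <= v k) ->
  (\int[lebesgue_measure]_y (smear y)%:E = \sum_(0 <= k <oo) (v k / rho)%:E)%E.
Proof.
move=> v0; rewrite {1}smear_restrict.
rewrite (_ : (fun y => _) = (EFin \o smear) \_ (\bigcup_k cell k)); last first.
  by rewrite restrict_EFin.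
rewrite -integral_mkcond ge0_integral_bigcup//=; last 3 first.
- exact/measurable_EFinP.
- by move=> y _; rewrite lee_fin /smear; case: ifP.
- move=> i j _ _ [y [/cell_rounding[_ <-] /cell_rounding[_ <-]]] //.
apply: eq_eseriesr => k _.
rewrite (eq_integral (cst (v k)%:E)); last by move=> y yk; rewrite (smear_cell yk).
rewrite integral_cst; last exact: mcell.
rewrite /cell/= lebesgue_measure_itv/= lte_fin ltr_pM2r ?invr_gt0//.
rewrite ltrD2r ltr_nat ltnSn -EFinB -EFinM; congr _%:E.
by rewrite -natr1; field; rewrite gt_eqF.
Qed.

End smearing.

Lemma smear_poisson_density lam L c y :
  poisson_density lam L y * c (rounding L y) =
  smear L (fun k => Num.sqrt L%:R * poisson_weight lam k * c k) y.
Proof. by rewrite /poisson_density /smear; case: ifP; rewrite ?mul0r. Qed.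

Lemma integral_poisson_density lam L c B : 0 <= lam -> (0 < L)%N ->
  (forall k, 0 <= c k <= B) ->
  (\int[lebesgue_measure]_y (poisson_density lam L y * c (rounding L y))%:E =
   (poisson_mean lam c)%:E)%E.
Proof.
move=> l0 L0 cB; under eq_integral do rewrite smear_poisson_density.
have c0 k : 0 <= c k by have /andP[] := cB k.
rewrite integral_smear// => [|k]; last first.
  by apply: mulr_ge0 => //; apply: mulr_ge0 => //; exact: poisson_weight_ge0.
rewrite /poisson_mean -EFin_lim; last first.
  apply: (@is_cvg_poisson_mean _ _ _ B) => k.
  by rewrite ger0_norm//; have /andP[] := cB k.
congr (limn _); apply/funext => n; rewrite /series/= sumEFin; congr _%:E.
apply: eq_bigr => k _; field.
by rewrite gt_eqF// sqrtr_gt0 ltr0n.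
Qed.

End poisson_local_limit.

Section poisson_clt.
Context (R : realType).
Local Notation leb := (@lebesgue_measure R).
Implicit Types (F : R -> R).

Let pdf : R -> R := normal_pdf 0 1.

Let integrable_pdf (F : measurableTypeR R -> R) : bounded_measurable F ->
  leb.-integrable setT (fun y => (pdf y * F y)%:E).
Proof.
move=> [mF [B FB]].
rewrite (_ : (fun y => _) = ((fun y => (pdf y)%:E) \* (EFin \o F))%E)//.
apply: integrableMl => //.
- exact: integrable_normal_pdf.
- exists B; split; first exact: num_real.
  by move=> z Bz x _ /=; rewrite (le_trans (FB x))// ltW.
Qed.

Let integral_normal (F : measurableTypeR R -> R) : bounded_measurable F ->
  \int[normal_prob 0 1]_y F y = \int[leb]_y (pdf y * F y).
Proof.
move=> bF.
apply: (bounded_functional_eq (L1 := fun F => \int[normal_prob 0 1]_y F y)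
  (L2 := fun F => \int[leb]_y (pdf y * F y))) => //.
- exact: bounded_functional_integral (probability_ltoo (normal_prob 0 1)).
- split=> [a phi psi bphi bpsi|].
    have ip := integrable_pdf bphi; have iq := integrable_pdf bpsi.
    have iap := integrable_pdf (bounded_measurableZ a bphi).
    rewrite -RintegralZl//.
    rewrite (_ : (fun y => a * (pdf y * phi y)) = (fun y => pdf y * (a * phi y))).
      by rewrite -RintegralD//; apply: eq_Rintegral => y _; ring.
    by apply/funext => y; ring.
  exists 1 => B phi bphi phiB; rewrite mul1r.
  have iB := integrable_pdf (bounded_measurable_cst _ B).
  have in_ := integrable_pdf (bounded_measurable_norm bphi).
  rewrite (le_trans (le_normr_Rintegral _ _))//; first exact: integrable_pdf.
  have -> : B = \int[leb]_y (pdf y * B).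
    rewrite RintegralZr//; last exact: integrable_normal_pdf.
    by rewrite /Rintegral integral_normal_pdf mul1r.
  rewrite (_ : (fun y => `|pdf y * phi y|) = (fun y => pdf y * `|phi y|)).
    by apply: le_Rintegral => // y _; rewrite ler_wpM2l ?normal_pdf_ge0.
  by apply/funext => y; rewrite normrM ger0_norm ?normal_pdf_ge0.
- move=> A mA; rewrite /Rintegral integral_indic// setIT.
  transitivity (fine (\int[leb]_(y in A) (pdf y)%:E)) => //.
  have E : (fun y => (pdf y)%:E) \_ A = (fun y => (pdf y * \1_A y)%:E).
    apply/funext => y.
    by rewrite patchE indicE; case: ifPn => _; rewrite ?mulr1 ?mulr0.
  by rewrite [X in fine X = _]integral_mkcond E.
Qed.

Let integrable_expN_norm :
  leb.-integrable setT (fun y => (expR (- `|y|))%:E).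
Proof.
have even_exp : (fun y => expR (- `|y|)) =1 (fun y : R => expR (- `|y|)) \o -%R.
  by move=> y /=; rewrite normrN.
have cexp : continuous (fun y : R => expR (- `|y|)).
  move=> y; apply: (cvg_comp _ expR); last exact: continuous_expR.
  by apply: cvgN; exact: norm_continuous.
apply/integrableP; split.
  by apply/measurable_EFinP; exact: continuous_measurable_fun.
under eq_integral do rewrite gee0_abs ?lee_fin ?expR_ge0//.
rewrite (ge0_symfun_integralT _ cexp even_exp) => [|y]; last exact: expR_ge0.
rewrite (eq_integral (fun y : measurableTypeR R => (exponential_pdf 1 y)%:E)) => [|y /set_mem/= y0].
  rewrite lte_mul_pinfty//.
  rewrite (@le_lt_trans _ _ (\int[leb]_y (exponential_pdf 1 y)%:E)%E)//.
    apply: ge0_subset_integral => //.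
    - by rewrite -set_itvcy.
    - by apply/measurable_EFinP; exact: measurable_exponential_pdf.
    - by move=> y _; rewrite lee_fin exponential_pdf_ge0.
  by rewrite integral_exponential_pdf// ltry.
by rewrite exponential_pdfE// /exponential_pdf mul1r ger0_norm// mulN1r.
Qed.

(** Central limit theorem for Poisson means of bounded sequences that need not
    be restrictions of a continuous function: convergence along the roundings
    suffices, because the standardized Poisson densities converge pointwise and
    dominatedly. The constant in the local limit theorem is identified by the
    case of the constant sequence 1. *)
Theorem cvg_poisson_mean (c : R) (lam : nat -> R) (L : nat -> nat)
    (v : nat -> nat -> R) (B : R) (F : measurableTypeR R -> R) :
  (forall n, 0 < lam n) -> (forall n, `|lam n - (L n)%:R| <= c) ->
  (L n)%:R @[n --> \oo] --> (+oo : set_system R) ->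
  (forall n k, `|v n k| <= B) -> bounded_measurable F ->
  {ae leb, forall y, v n (rounding (L n) y) @[n --> \oo] --> F y} ->
  poisson_mean (lam n) (v n) @[n --> \oo] --> \int[normal_prob 0 1]_y F y.
Proof.
have [C cvC] := @cvg_poisson_density R.
(* the sequence is first taken nonnegative, so that the integrals over the cells
   can be summed, and [L n] large enough for [poisson_density_ub] *)
have cvgC01 (c' B' : R) (lam' : nat -> R) (L' : nat -> nat) v' (F' : measurableTypeR R -> R) :
    (forall n, 16 <= L' n)%N ->
    (forall n, 0 < lam' n) -> (forall n, `|lam' n - (L' n)%:R| <= c') ->
    (L' n)%:R @[n --> \oo] --> (+oo : set_system R) ->
    (forall n k, 0 <= v' n k <= B') -> bounded_measurable F' ->
    {ae leb, forall y, v' n (rounding (L' n) y) @[n --> \oo] --> F' y} ->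
    poisson_mean (lam' n) (v' n) @[n --> \oo] -->
      C / normal_peak 1 * \int[normal_prob 0 1]_y F' y.
  move=> L16 l0 lL Loo vB bF cvF; have [mF _] := bF.
  have [B0 densB] := poisson_density_ub c'.
  have L0 n : (0 < L' n)%N by exact: leq_trans (L16 n).
  pose f_ n (y : measurableTypeR R) : \bar R :=
    (poisson_density (lam' n) (L' n) y * v' n (rounding (L' n) y))%:E.
  pose g_ (y : measurableTypeR R) : \bar R := (C * expR (- (y ^+ 2 / 2)) * F' y)%:E.
  pose D (y : measurableTypeR R) : \bar R := ((B0 * B')%:E * (expR (- `|y|))%:E)%E.
  have pdfE y : C * expR (- (y ^+ 2 / 2)) = C / normal_peak 1 * pdf y.
    rewrite /pdf normal_pdfE ?oner_neq0// mulrA divfK; last first.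
      by rewrite gt_eqF// normal_peak_gt0// oner_neq0.
    by rewrite /normal_fun subr0 expr1n mulNr.
  have [] := @dominated_convergence _ _ _ leb setT measurableT f_ g_ D.
  - move=> n; apply/measurable_EFinP; rewrite /f_.
    under eq_fun do rewrite smear_poisson_density.
    exact: measurable_smear.
  - apply/measurable_EFinP; rewrite /g_; apply: measurable_funM => //.
    under eq_fun do rewrite pdfE.
    apply: measurable_funM => //; exact: measurable_normal_pdf.
  - apply: (@filterS _ _ (ae_filter_ringOfSetsType leb) _ _ _ cvF) => y vF _; apply: cvg_EFin; first exact: nearW.
    exact: cvgM (cvC _ _ _ l0 lL Loo y) vF.
  - exact: integrableZl integrable_expN_norm.
  - apply: aeW => y n _; rewrite /f_ /D -EFinM lee_fin.
    have /andP[v0 v1] := vB n (rounding (L' n) y).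
    have d0 := poisson_density_ge0 (L' n) y (ltW (l0 n)).
    rewrite ger0_norm ?mulr_ge0// mulrAC ler_pM//.
    exact: densB.
  move=> ig _ cvf.
  have -> : C / normal_peak 1 * \int[normal_prob 0 1]_y F' y =
      fine (\int[leb]_y g_ y)%E.
    rewrite integral_normal// -RintegralZl//; last exact: integrable_pdf.
    by congr fine; apply: eq_integral => y _; rewrite /g_ pdfE mulrA.
  have : fine (\int[leb]_y f_ n y)%E @[n --> \oo] --> fine (\int[leb]_y g_ y)%E.
    by apply: fine_cvg; rewrite fineK//; exact: integrable_fin_num.
  by under eq_fun => n do rewrite (integral_poisson_density (ltW (l0 n)) (L0 n) (vB n)).
have CE : C / normal_peak 1 = 1.
  have oo16 : (n + 16)%:R @[n --> \oo] --> (+oo : set_system R).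
    by rewrite (cvg_shiftn _ (fun n => n%:R : R)); exact: cvgr_idn.
  have int1 : \int[normal_prob 0 1]_y (fun=> 1 : R) y = 1 :> R.
    exact: Rintegral_cst_probability.
  have : poisson_mean (n + 16)%:R (fun=> 1) @[n --> \oo] --> C / normal_peak 1.
    rewrite -[X in _ --> X]mulr1 -[X in _ * X]int1.
    apply: (@cvgC01 0 1 _ (fun n => (n + 16)%N) (fun _ _ => 1) (fun=> 1)) => //.
    + by move=> n; rewrite leq_addl.
    + by move=> n /=; rewrite subrr normr0.
    + by move=> _ _; rewrite ler01 lexx.
    + exact: bounded_measurable_cst.
    + by apply: aeW => y; exact: cvg_cst.
  rewrite (_ : (fun n => _) = cst 1); last first.
    by apply/funext => n; rewrite poisson_mean_cst.
  by move=> cv1; exact: cvg_unique cv1 (cvg_cst (1 : R)).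
move=> l0 lL Loo vB bF cvF.
have [N _ LN] : \forall n \near \oo, (16 <= L n)%N.
  by move/cvgryPge : Loo => /(_ 16); apply: filterS => n; rewrite (ler_nat _ 16).
have B0 : 0 <= B by exact: le_trans (vB 0%N 0%N).
rewrite -(@cvg_shiftn N).
have := @cvgC01 c (B + B) (fun n => lam (n + N)%N) (fun n => L (n + N)%N)
  (fun n k => v (n + N)%N k + B) (fun y => F y + B).
have -> : \int[normal_prob 0 1]_y (F y + B) = \int[normal_prob 0 1]_y F y + B.
  have P1y := probability_ltoo (normal_prob (0 : R) 1).
  rewrite RintegralD//; last 2 first.
    exact: (bounded_measurable_integrable P1y bF).
    exact: (bounded_measurable_integrable P1y (bounded_measurable_cst _ B)).
  by congr (_ + _); exact: (Rintegral_cst_probability (normal_prob 0 1)).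
rewrite CE mul1r => cv1.
have cv2 : poisson_mean (lam (n + N)%N) (fun k => v (n + N)%N k + B) @[n --> \oo]
    --> \int[normal_prob 0 1]_y F y + B.
  apply: cv1 => //.
  - by move=> n; apply: LN; rewrite /= leq_addl.
  - by rewrite (cvg_shiftn _ (fun n => (L n)%:R : R)).
  - move=> n k; have := vB (n + N)%N k; rewrite ler_norml => /andP[? ?].
    by apply/andP; split; lra.
  - by apply: bounded_measurableD => //; exact: bounded_measurable_cst.
  apply: (@filterS _ _ (ae_filter_ringOfSetsType leb) _ _ _ cvF) => y cvy.
  apply: cvgD; last exact: cvg_cst.
  rewrite (cvg_shiftn _ (fun n => v n (rounding (L n) y))).
  exact: cvy.
pose proof (cvgB cv2 (cvg_cst B)) as H; rewrite addrK in H.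
apply: (cvg_trans _ H); apply: near_eq_cvg; apply: nearW => n /=.
rewrite ?fctE /= (_ : (fun k => _) = (fun k => 1 * v (n + N)%N k + B)); last first.
  by apply/funext => k; rewrite mul1r.
rewrite (@poisson_meanD _ _ _ _ (fun=> B) B B)//; last by rewrite ger0_norm.
by rewrite poisson_mean_cst mul1r addrK.
Qed.

End poisson_clt.

(** * Convergence in distribution *)

Lemma cvg_Rintegral_bounded d (T : measurableType d) (R : realType)
    (mu : {measure set T -> \bar R}) (u : nat -> T -> R) (phi : T -> R) (B : R) :
  (mu setT < +oo)%E -> (forall n, measurable_fun setT (u n)) ->
  (forall n x, `|u n x| <= B) ->
  (forall x, u n x @[n --> \oo] --> phi x) ->
  \int[mu]_x u n x @[n --> \oo] --> \int[mu]_x phi x.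
Proof.
move=> muT mu_ uB uphi.
have mphi : measurable_fun setT phi.
  by apply: (measurable_fun_cvg (h := u)) => // x _; exact: uphi.
have phiB x : `|phi x| <= B.
  have /cvg_lim <- // : `|u n x| @[n --> \oo] --> `|phi x| by exact: cvg_norm.
  apply: limr_le; first by apply/cvg_ex; exists `|phi x|; exact: cvg_norm.
  exact: nearW.
have bphi : bounded_measurable phi by split=> //; exists B.
have [] := @dominated_convergence _ _ _ mu setT measurableT
  (fun n => EFin \o u n) (EFin \o phi) (cst B%:E).
- by move=> n; exact/measurable_EFinP.
- exact/measurable_EFinP.
- by apply: aeW => x _; apply: cvg_EFin; [exact: nearW|exact: uphi].
- exact: (bounded_measurable_integrable muT (bounded_measurable_cst _ B)).
- by apply: aeW => x n _; rewrite lee_fin.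
move=> ig _ cv; apply: fine_cvg; rewrite fineK//; exact: integrable_fin_num.
Qed.

Section extended_mapping.
Context (R : realType) (P : ptopologicalType) (pP : polish R P).

Lemma continuous_borel_measurable (phi : P -> R) :
  continuous phi -> measurable_fun setT (phi : borel P -> R).
Proof.
move=> cphi; apply: (measurability _ (RGenOpens.measurableE R)) => _ [_ [x [y ->]] <-].
rewrite setTI; apply: sub_sigma_algebra.
by apply: open_comp (interval_open _ _) => // z _; exact: cphi.
Qed.

Context d (Omega : measurableType d) (Pr : probability Omega R).
Variables (X : nat -> Omega -> borel P) (gamma : probability (borel P) R).
Hypothesis mX : forall n, measurable_fun setT (X n).
Hypothesis cvX : cvg_in_distribution Pr X gamma.

Let finite_Pr : (Pr setT < +oo)%E.
Proof. exact: probability_ltoo. Qed.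
Let finite_gamma : (gamma setT < +oo)%E.
Proof. exact: probability_ltoo. Qed.

Section envelope.
Variables (dist : P -> P -> R).
Hypothesis dist0 : forall x y, dist x y = 0 <-> x = y.
Hypothesis distC : forall x y, dist x y = dist y x.
Hypothesis distD : forall x y z, dist x z <= dist x y + dist y z.
Hypothesis nbhs_dist : forall (x : P) (A : set P),
  nbhs x A <-> exists2 e : R, 0 < e & [set y | dist x y < e] `<=` A.

Variables (u : nat -> P -> R) (B : R).
Hypothesis uB : forall n x, `|u n x| <= B.

Let distxx x : dist x x = 0. Proof. exact/dist0. Qed.

Let dist_ge0 x y : 0 <= dist x y.
Proof. by have := distD x y x; rewrite (distC y x) distxx; lra. Qed.

(** The Pasch-Hausdorff envelope: the largest [k]-Lipschitz function below all
    the [u n] with [k <= n]. *)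
Definition envelope k (x : P) : R :=
  inf [set u nz.1 nz.2 + k%:R * dist x nz.2 | nz in [set nz | (k <= nz.1)%N]].

Let has_inf_envelope k x :
  has_inf [set u nz.1 nz.2 + k%:R * dist x nz.2 | nz in [set nz | (k <= nz.1)%N]].
Proof.
split; first by exists (u k x + k%:R * dist x x); exists (k, x) => /=.
exists (- B) => _ [[n y] _ <-] /=.
have := uB n y; rewrite ler_norml => /andP[h _].
by rewrite (le_trans h)// lerDl mulr_ge0.
Qed.

Let envelope_le_gen k n x y : (k <= n)%N -> envelope k x <= u n y + k%:R * dist x y.
Proof.
by move=> kn; apply: (inf_lbound (has_inf_envelope k x).2); exists (n, y).
Qed.

Let envelope_ge k x c :
  (forall n y, (k <= n)%N -> c <= u n y + k%:R * dist x y) -> c <= envelope k x.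
Proof.
move=> h; apply: lb_le_inf; first exact: (has_inf_envelope k x).1.
by move=> _ [[n y] kn <-]; exact: h.
Qed.

Let envelope_le k n x : (k <= n)%N -> envelope k x <= u n x.
Proof.
move=> kn; have := envelope_le_gen x x kn.
by rewrite distxx mulr0 addr0.
Qed.

Let envelope_bounded k x : `|envelope k x| <= B.
Proof.
rewrite ler_norml; apply/andP; split.
  apply: envelope_ge => n y _; have := uB n y; rewrite ler_norml => /andP[h _].
  by rewrite (le_trans h)// lerDl mulr_ge0.
rewrite (le_trans (envelope_le x (leqnn k)))//.
by have := uB k x; rewrite ler_norml => /andP[].
Qed.

Let envelope_lipschitz k x y : envelope k x - envelope k y <= k%:R * dist x y.
Proof.
rewrite lerBlDr -lerBlDl; apply: envelope_ge => n z kn.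
rewrite lerBlDl (le_trans (envelope_le_gen x z kn))//.
by rewrite addrCA lerD2l -mulrDr ler_wpM2l.
Qed.

Let continuous_envelope k : continuous (envelope k).
Proof.
move=> x; apply/cvgrPdist_le => e e0.
apply/nbhs_dist; exists (e / k.+1%:R); first by rewrite divr_gt0.
move=> y /=; rewrite ltr_pdivlMr// => xy.
have kxy : k%:R * dist x y <= e.
  by rewrite (le_trans _ (ltW xy))// mulrC ler_wpM2l// ler_nat.
rewrite ler_norml lerNl opprB.
apply/andP; split; apply: le_trans (envelope_lipschitz _ _ _) _ => //.
by rewrite distC.
Qed.

Let cvg_envelope (x : P) (l : R) :
  u z.1 z.2 @[z --> filter_prod \oo (nbhs x)] --> l ->
  envelope k x @[k --> \oo] --> l.
Proof.
move=> /cvgrPdist_le ul; apply/cvgrPdist_le => e e0.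
have [[A1 A2] /= [[N _ NA1] /nbhs_dist[r r0 rA2]] A12] := ul _ e0.
have ule n y : (N <= n)%N -> dist x y < r -> `|l - u n y| <= e.
  by move=> Nn xy; apply: (A12 (n, y)); split; [exact: NA1|exact: rA2].
have lB : l - e <= B.
  have := ule N x (leqnn _); rewrite distxx => /(_ r0).
  have := uB N x; rewrite !ler_norml => /andP[_ ?] /andP[_ ?]; lra.
near=> k.
have Nk : (N <= k)%N by near: k; exact: nbhs_infty_ge.
have kr : 2 * B <= k%:R * r.
  by rewrite -ler_pdivrMr//; near: k; exact: nbhs_infty_ger.
have h1 : envelope k x <= l + e.
  rewrite (le_trans (envelope_le x (leqnn k)))//.
  by have := ule k x Nk; rewrite distxx ler_norml => /(_ r0)/andP[? ?]; lra.
have h2 : l - e <= envelope k x.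
  apply: envelope_ge => n y kn; have [xy|xy] := ltP (dist x y) r.
    have := ule n y (leq_trans Nk kn) xy; rewrite ler_norml => /andP[_ ?].
    have : 0 <= k%:R * dist x y by rewrite mulr_ge0.
    by lra.
  have : k%:R * r <= k%:R * dist x y by rewrite ler_wpM2l.
  by have := uB n y; rewrite ler_norml => /andP[? _]; lra.
by rewrite ler_norml; lra.
Unshelve. all: by end_near. Qed.

Lemma integral_extended_ge (G : P -> R) e :
  (forall n, measurable_fun setT (u n : borel P -> R)) ->
  (forall x, u z.1 z.2 @[z --> filter_prod \oo (nbhs x)] --> G x) -> 0 < e ->
  \forall n \near \oo,
    \int[gamma]_x (G : borel P -> R) x - e <= \int[Pr]_w u n (X n w).
Proof.
move=> mu_ uG e0.
have cvenv := cvg_Rintegral_bounded finite_gamma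
  (fun k => continuous_borel_measurable (@continuous_envelope k))
  envelope_bounded (fun x => cvg_envelope (uG x)).
have e20 : 0 < e / 2 by rewrite divr_gt0.
have [k _ /(_ k (leqnn k))/= hk] := (cvgrPdist_le _ _).1 cvenv _ e20.
pose h : bounded_continuous R P := exist _ (envelope k)
  (conj (@continuous_envelope k) (ex_intro _ B (envelope_bounded k))).
have hn := (cvgrPdist_le _ _).1 (@cvX h) _ e20.
near=> n.
have kn : (k <= n)%N by near: n; exact: nbhs_infty_ge.
have hn' : `|\int[gamma]_x envelope k x - \int[Pr]_w envelope k (X n w)| <= e / 2.
  by near: n; exact: hn.
have : \int[Pr]_w envelope k (X n w) <= \int[Pr]_w u n (X n w).
  apply: le_Rintegral => //.
  - apply: bounded_measurable_integrable => //; split; last by exists B.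
    by apply: measurableT_comp (mX n); exact: continuous_borel_measurable.
  - apply: bounded_measurable_integrable => //; split; last by exists B.
    exact: measurableT_comp (mX n).
  - by move=> w _; exact: envelope_le.
move: hk hn'; rewrite !ler_norml => /andP[? ?] /andP[? ?]; lra.
Unshelve. all: by end_near. Qed.

End envelope.

(** The extended continuous mapping theorem, for functions [u n] that vary with
    [n]. The envelopes of [u] and of [- u] squeeze the integrals of [u n] between
    integrals of fixed Lipschitz functions, which converge by assumption and
    whose limits tend to the integral of [G] by dominated convergence. *)
Theorem cvg_integral_extended (u : nat -> P -> R) (G : P -> R) (B : R) :
  (forall n x, `|u n x| <= B) ->
  (forall n, measurable_fun setT (u n : borel P -> R)) ->
  (forall x, u z.1 z.2 @[z --> filter_prod \oo (nbhs x)] --> G x) ->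
  \int[Pr]_w u n (X n w) @[n --> \oo] --> \int[gamma]_x (G : borel P -> R) x.
Proof.
move=> uB mu_ uG; have [dist [[d0 dC dD] nd _ _]] := pP.
have NuB n' x : `|- u n' x| <= B by rewrite normrN.
have Nmu n' : measurable_fun setT ((fun x => - u n' x) : borel P -> R).
  exact: measurable_funN.
have NuG x : - u z.1 z.2 @[z --> filter_prod \oo (nbhs x)] --> - G x.
  by apply: cvgN; exact: uG.
apply/cvgrPdist_le => e e0; near=> n.
have low : \int[gamma]_x G x - e <= \int[Pr]_w u n (X n w).
  by near: n; exact: (integral_extended_ge d0 dC dD nd uB).
have upp : \int[gamma]_x (- G x) - e <= \int[Pr]_w - u n (X n w).
  by near: n; exact: (integral_extended_ge d0 dC dD nd NuB).
have uG1 x : u n x @[n --> \oo] --> G x.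
  apply: cvg_trans (uG x) => A [[A1 A2] /= [A1n A2x] A12].
  by apply: filterS A1n => m A1m; apply: (A12 (m, x)); split=> //; exact: nbhs_singleton.
have bu : bounded_measurable (fun w => u n (X n w)).
  by split; [exact: measurableT_comp (mX n)|exists B].
have bG : bounded_measurable (G : borel P -> R).
  split.
    apply: (@measurable_fun_cvg _ (borel P) R setT u) => [n'|x _]; first exact: mu_.
    exact: uG1.
  exists B => x; have /cvg_lim <- // : `|u n x| @[n --> \oo] --> `|G x|
    by apply: cvg_norm; exact: uG1.
  apply: limr_le; last exact: nearW.
  by apply/cvg_ex; exists `|G x|; apply: cvg_norm; exact: uG1.
have NE d' (T : measurableType d') (mu : {measure set T -> \bar R}) (phi : T -> R) :
    (mu setT < +oo)%E -> bounded_measurable phi ->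
    \int[mu]_x (- phi x) = - \int[mu]_x phi x.
  move=> muT bphi; rewrite -mulN1r -RintegralZl//.
    by apply: eq_Rintegral => x _; rewrite mulN1r.
  exact: bounded_measurable_integrable.
by move: low upp; rewrite !NE// ler_norml => ? ?; apply/andP; split; lra.
Unshelve. all: by end_near. Qed.

End extended_mapping.

(** * The companion chain at a Gaussian time *)

Section kernel_operator.
Context d (T : measurableType d) (R : realType) (K : R.-pker T ~> T).
Implicit Types (phi psi : T -> R) (x : T) (k : nat).

Definition kernel_op phi x : R := \int[K x]_y phi y.

Lemma kernel_ltoo x : (K x setT < +oo)%E.
Proof. by rewrite prob_kernel ltry. Qed.

Lemma kernel_op_le phi B x : bounded_measurable phi ->
  (forall y, `|phi y| <= B) -> `|kernel_op phi x| <= B.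
Proof.
move=> bphi phiB; have iphi := bounded_measurable_integrable (kernel_ltoo x) bphi.
rewrite (le_trans (le_normr_Rintegral _ iphi))//.
have -> : B = \int[K x]_y B by rewrite Rintegral_cst// prob_kernel mulr1.
apply: le_Rintegral => //.
- exact: (bounded_measurable_integrable (kernel_ltoo x) (bounded_measurable_norm bphi)).
- exact: (bounded_measurable_integrable (kernel_ltoo x) (bounded_measurable_cst _ B)).
Qed.

Lemma bounded_measurable_kernel_op phi : bounded_measurable phi ->
  bounded_measurable (kernel_op phi).
Proof.
move=> bphi; have [_ [B phiB]] := bphi; split; last first.
  by exists B => x; exact: kernel_op_le.
by apply: measurable_integral_family => // [x|A mA];
  [exact: kernel_ltoo|exact: measurable_kernel].
Qed.

Lemma kernel_opD a phi psi : bounded_measurable phi -> bounded_measurable psi ->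
  kernel_op (fun x => a * phi x + psi x) =
  (fun x => a * kernel_op phi x + kernel_op psi x).
Proof.
by move=> bphi bpsi; apply/funext => x;
  exact: (bounded_functional_integral (kernel_ltoo x)).1.
Qed.

Lemma bounded_measurable_iter k phi : bounded_measurable phi ->
  bounded_measurable (iter k kernel_op phi).
Proof. by move=> bphi; elim: k => //= k; exact: bounded_measurable_kernel_op. Qed.

Lemma iter_kernel_op_le k phi B x : bounded_measurable phi ->
  (forall y, `|phi y| <= B) -> `|iter k kernel_op phi x| <= B.
Proof.
move=> bphi phiB; elim: k x => //= k IH x.
by apply: kernel_op_le => //; exact: bounded_measurable_iter.
Qed.

Lemma iter_kernel_opD k a b phi psi : bounded_measurable phi ->
  bounded_measurable psi -> iter k (kernel_op) (fun x => a * phi x + b * psi x) =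
  (fun x => a * iter k kernel_op phi x + b * iter k kernel_op psi x).
Proof.
move=> bphi bpsi; elim: k => //= k ->.
have biphi := bounded_measurable_iter k bphi.
have bipsi := bounded_measurable_iter k bpsi.
rewrite kernel_opD//; last exact: bounded_measurableZ.
apply/funext => x; congr (_ + _).
exact: (bounded_functionalZ _ (bounded_functional_integral (kernel_ltoo x))).
Qed.

End kernel_operator.

Lemma markov_chain_mean (R : realType) (P : ptopologicalType)
    (K : R.-pker (borel P) ~> (borel P)) (x : borel P)
    d (Omega : measurableType d) (Pr : probability Omega R)
    (W : nat -> Omega -> borel P) (phi : borel P -> R) k :
  markov_chain Pr (\d_x) K W -> bounded_measurable phi ->
  \int[Pr]_w phi (W k w) = iter k (kernel_op K) phi x.
Proof.
move=> [mW W0 WS].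
have Pr_oo := probability_ltoo Pr.
have bW n psi : bounded_measurable psi -> bounded_measurable (fun w => psi (W n w)).
  exact: (bounded_measurable_comp (mW n)).
have functional_W n : bounded_functional (fun psi : borel P -> R => \int[Pr]_w psi (W n w)).
  have [DPr [c cPr]] := bounded_functional_integral Pr_oo.
  split=> [a psi1 psi2 b1 b2|]; first by apply: DPr; exact: bW.
  by exists c => B psi bpsi psiB; apply: cPr => //; exact: bW.
have indicW n A : measurable A -> \int[Pr]_w (\1_A (W n w)) = fine (Pr (W n @^-1` A)).
  move=> mA; rewrite /Rintegral -(setIT (W n @^-1` A)) -integral_indic//.
  by rewrite -[_ @^-1` _]setTI; exact: mW.
elim: k phi => [|k IH] phi bphi.
  apply: (bounded_functional_eq (functional_W 0%N) (L2 := fun psi => psi x) _ _ bphi).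
    split=> //; exists 1 => B psi _ psiB; rewrite mul1r; exact: psiB.
  by move=> A mA; rewrite indicW// W0// diracE indicE.
rewrite iterSr -IH; last exact: bounded_measurable_kernel_op.
apply: (bounded_functional_eq (functional_W k.+1)
  (L2 := fun psi => \int[Pr]_w kernel_op K psi (W k w)) _ _ bphi).
  have [DW [c cW]] := functional_W k.
  split=> [a psi1 psi2 b1 b2|].
    by rewrite kernel_opD// DW//; exact: bounded_measurable_kernel_op.
  exists c => B psi bpsi psiB; apply: cW => [|y].
    exact: bounded_measurable_kernel_op.
  exact: kernel_op_le.
move=> A mA; rewrite indicW// -[W k.+1 @^-1` A]setTI WS//; last first.
  by apply: sub_sigma_algebra; exists k => //=; exists setT.
rewrite /Rintegral; congr fine; apply: eq_integral => w _.
rewrite /kernel_op /Rintegral integral_indic// setIT fineK//.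
rewrite ge0_fin_numE//; apply: le_lt_trans (kernel_ltoo K (W k w)).
by apply: le_measure; rewrite ?inE.
Qed.

Lemma cvg_rounding (R : realType) (y : R) : rounding n y @[n --> \oo] --> \oo.
Proof.
apply/cvgnyPge => M; near=> n.
pose r : R := Num.sqrt n%:R; pose c : R := `|y| + M.+1%:R.
have rc : c <= r.
  rewrite -[c]ger0_norm ?addr_ge0// -sqrtr_sqr ler_wsqrtr//.
  by near: n; exact: nbhs_infty_ger.
apply: ltnW; rewrite truncn_gt_nat.
have -> : n%:R + y * Num.sqrt n%:R = (r + y) * r.
  by rewrite mulrDl -expr2 sqr_sqrtr.
have M1 : 1 <= M.+1%:R :> R by rewrite ler1n.
have yy := ler_norm (- y); rewrite normrN in yy.
have y0 := normr_ge0 y.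
rewrite -[leLHS]mulr1 ler_pM//; rewrite /c in rc; lra.
Unshelve. all: by end_near. Qed.

Section companion_limit.
Context (R : realType) (P : ptopologicalType) (pP : polish R P).
Context (N : normalization R P) (K : R.-pker (borel P) ~> (borel P)).
Context (a : nat -> scalars N) (b : nat -> offsets N).
Hypothesis ua : forall n, sunit (a n).
Context (gamma : probability (borel P) R) (erg : ergodic K a b gamma).
Context (f : R -> offsets N) (g : R -> scalars N).
Hypotheses (mf : borel_measurable (f : measurableTypeR R -> offsets N)).
Hypotheses (mg : borel_measurable (g : measurableTypeR R -> scalars N)).
Hypothesis fluct : regular_fluctuations a b f g.
Context (h : bounded_continuous R P).

(** The right-hand side involves [a] and [b] only through the normalization at
    time [k] and the two quantities that [regular_fluctuations] controls. *)
Lemma normalize_change (k n : nat) (x : P) :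
  normalize N (a n) (b n) x =
  translate (dilate (smul (a k) (sinv (a n))) (normalize N (a k) (b k) x))
    (sdilate (sinv (a n)) (b k - b n)).
Proof.
rewrite /normalize smulC dilateM -(dilateM (a k)) (smulC (a k)) smulVs// dilate1.
by rewrite -dilate_translate -translateD addrA addNr add0r.
Qed.

Definition normalized_test n : borel P -> R :=
  fun x => sval h (normalize N (a n) (b n) x).

Lemma bounded_measurable_sval : bounded_measurable (sval h : borel P -> R).
Proof.
by have [ch hB] := svalP h; split=> //; exact: continuous_borel_measurable.
Qed.

Lemma bounded_measurable_normalized_test n : bounded_measurable (normalized_test n).
Proof.
exact: (bounded_measurable_comp (measurable_normalize (a n) (b n))
  bounded_measurable_sval).
Qed.

Definition limit_mean (y : measurableTypeR R) : R :=
  \int[gamma]_z sval h (limit_map f g (z, y)).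

Let gamma_ltoo : (gamma setT < +oo)%E.
Proof. exact: probability_ltoo. Qed.

Let bounded_measurable_h_limit_map :
  measurable_fun setT (sval h \o limit_map f g) /\
  exists B, forall z, `|sval h (limit_map f g z)| <= B.
Proof.
exact: bounded_measurable_comp (measurable_limit_map pP mf mg)
  bounded_measurable_sval.
Qed.

Let integrable_h_limit_map :
  (gamma \x normal_prob 0 1)%E.-integrable setT (EFin \o (sval h \o limit_map f g)).
Proof.
apply: bounded_measurable_integrable => //.
by apply: le_lt_trans (probability_le1 _ _) _; rewrite ?ltry.
Qed.

Let bounded_measurable_section y :
  bounded_measurable (fun z => sval h (limit_map f g (z, y))).
Proof.
have [mh [B hB]] := bounded_measurable_h_limit_map.
by split; [apply: measurableT_comp mh _; exact: measurable_pair2|exists B].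
Qed.

Lemma bounded_measurable_limit_mean : bounded_measurable limit_mean.
Proof.
split.
  apply: measurableT_comp => //.
  exact: measurable_fubini_G integrable_h_limit_map.
have [_ [B hB]] := bounded_measurable_h_limit_map; exists B => y.
have by_ := bounded_measurable_section y.
rewrite (le_trans (le_normr_Rintegral _ (bounded_measurable_integrable gamma_ltoo by_)))//.
have -> : B = \int[gamma]_y B.
  exact/esym/Rintegral_cst_probability.
apply: le_Rintegral => //.
- exact: (bounded_measurable_integrable gamma_ltoo (bounded_measurable_norm by_)).
- exact: (bounded_measurable_integrable gamma_ltoo (bounded_measurable_cst _ B)).
Qed.

Lemma integral_limit_mean :
  \int[limit_measure pP mf mg gamma]_x sval h x = \int[normal_prob 0 1]_y limit_mean y.
Proof.
have mlm := measurable_limit_map pP mf mg.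
transitivity (fine (\int[pushforward (gamma \x normal_prob 0 1)%E (limit_map f g)]_x
  (sval h x)%:E)) => //.
rewrite integral_pushforward ?preimage_setT//.
- rewrite /Rintegral -(integral21_prod_meas1 integrable_h_limit_map).
  congr fine; apply: eq_integral => y _; rewrite /fubini_G /limit_mean fineK//.
  apply: integrable_fin_num => //.
  exact: (bounded_measurable_integrable gamma_ltoo (bounded_measurable_section y)).
- by apply/measurable_EFinP; have [] := bounded_measurable_sval.
Qed.

(** Slutsky's lemma along the subsequence of times [rounding n y]: the ratio of
    the normalizations converges by [fluct]. *)
Lemma cvg_normalized_chain (x : borel P) :
  {ae lebesgue_measure, forall y : R,
    iter (rounding n y) (kernel_op K) (normalized_test n) x @[n --> \oo] -->
      limit_mean y}.
Proof.
have [d0 [T0 [Pr [W [mc cvW]]]]] := erg (\d_x).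
apply: (@filterS _ _ (ae_filter_ringOfSetsType lebesgue_measure) _ _ _ fluct) => y.
move=> /(_ (fun=> 0))[|cvb cva].
  apply/eqoP => e e0; apply: nearW => n.
  by rewrite normr0 mulr_ge0// ltW.
rewrite /= in cvb cva.
pose k n := rounding n y.
have kE n : Num.truncn (n%:R + y * Num.sqrt n%:R + 0) = k n by rewrite addr0.
pose X n w : borel P := normalize N (a (k n)) (b (k n)) (W (k n) w).
have mX n : measurable_fun setT (X n).
  apply: measurableT_comp; first exact: measurable_normalize.
  exact: markov_chain_measurable mc _.
have cvX : cvg_in_distribution Pr X gamma.
  by move=> h'; exact: cvg_comp (cvg_rounding y) (@cvW h').
pose s n := smul (a (k n)) (sinv (a n)).
pose v n := sdilate (sinv (a n)) (b (k n) - b n).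
have cvs : s n @[n --> \oo] --> g y.
  apply: (cvg_trans _ cva); apply: near_eq_cvg; apply: nearW => n.
  by rewrite kE.
have cvv : v n @[n --> \oo] --> f y.
  apply: (cvg_trans _ cvb); apply: near_eq_cvg; apply: nearW => n.
  by rewrite kE.
have [ch [B hB]] := svalP h.
pose phi (z : (scalars N * P) * offsets N) := sval h (translate (dilate z.1.1 z.1.2) z.2).
have cphi : continuous phi.
  move=> z; apply: (@continuous_comp _ _ _ (fun z : (scalars N * P) * offsets N =>
    translate (dilate z.1.1 z.1.2) z.2) (sval h)); last exact: ch.
  apply: (@continuous_comp _ _ _ (fun z : (scalars N * P) * offsets N =>
    (dilate z.1.1 z.1.2, z.2)) (fun z => translate z.1 z.2));
    last exact: translate_continuous.
  apply: cvg_pair; last exact: cvg_snd.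
  apply: (@continuous_comp _ _ _ fst (fun z => dilate z.1 z.2));
    [exact: cvg_fst|exact: dilate_continuous].
have := @cvg_integral_extended R P pP _ _ _ _ _ mX cvX
  (fun n x => phi ((s n, x), v n)) (fun x => phi ((g y, x), f y)) B.
rewrite (_ : (fun n => \int[Pr]_w _) =
    (fun n => iter (k n) (kernel_op K) (normalized_test n) x)); last first.
  apply/funext => n.
  rewrite -(markov_chain_mean _ mc (bounded_measurable_normalized_test n)).
  by apply: eq_Rintegral => w _; rewrite /normalized_test (normalize_change (k n)).
apply.
- by move=> n z; exact: hB.
- move=> n; apply: continuous_borel_measurable => z.
  apply: (@continuous_comp _ _ _ (fun z => ((s n, z), v n)) phi); last exact: cphi.
  have snz : ((fun z0 : P => (s n, z0)) @ z --> (s n, z)).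
    by apply: cvg_pair; [exact: cvg_cst|exact: cvg_id].
  exact: cvg_pair snz (cvg_cst (v n)).
move=> z.
have pr : (fun nz : nat * P => ((s nz.1, nz.2), v nz.1)) @ filter_prod \oo (nbhs z) -->
    ((g y, z), f y).
  have prs : (fun nz : nat * P => (s nz.1, nz.2)) @ filter_prod \oo (nbhs z) -->
      (g y, z).
    apply: (@cvg_pair _ _ _ _ (nbhs (g y)) (nbhs z)); last exact: cvg_snd.
    exact: cvg_comp cvg_fst cvs.
  apply: (@cvg_pair _ _ _ _ (nbhs (g y, z)) (nbhs (f y))) => //.
  exact: cvg_comp cvg_fst cvv.
exact: cvg_comp pr (cphi _).
Qed.

Lemma cvg_poisson_mean_chain (c : R) (lam : nat -> R) (L : nat -> nat) (x : borel P) :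
  (forall n, 0 < lam n) -> (forall n, `|lam n - (L n)%:R| <= c) ->
  (L n)%:R @[n --> \oo] --> (+oo : set_system R) ->
  poisson_mean (lam n)
    (fun k => iter k (kernel_op K) (normalized_test (L n)) x) @[n --> \oo] -->
  \int[limit_measure pP mf mg gamma]_x sval h x.
Proof.
move=> l0 lL Loo; rewrite integral_limit_mean.
have [_ [B hB]] := bounded_measurable_sval.
have L_oo : L n @[n --> \oo] --> \oo.
  apply/cvgnyPge => M; move/cvgryPge : Loo => /(_ M%:R).
  by apply: filterS => n; rewrite ler_nat.
apply: (cvg_poisson_mean (c := c) (L := L) (B := B)) => //.
- move=> n k; apply: iter_kernel_op_le; first exact: bounded_measurable_normalized_test.
  by move=> y; exact: hB.
- exact: bounded_measurable_limit_mean.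
apply: (@filterS _ _ (ae_filter_ringOfSetsType lebesgue_measure) _ _ _
  (cvg_normalized_chain x)) => y cvy.
exact: (cvg_comp L (fun l => iter (rounding l y) (kernel_op K) (normalized_test l) x)
  L_oo cvy).
Qed.

End companion_limit.

(** * The second moment of the urn *)

Section urn.
Context (R : realType) (P : ptopologicalType).
Context (K : R.-pker (borel P) ~> (borel P)).
Context (M0 : finite_measures R P) (M0_gt0 : (0 < M0 setT)%E).
Context d (Omega : measurableType d) (Pr : probability Omega R).
Context (C : nat -> Omega -> borel P) (M : nat -> Omega -> finite_measures R P).
Hypothesis hM : mvpp Pr M0 K C M.
Implicit Types (phi psi : borel P -> R) (w : Omega) (n : nat).

Definition initial_mass : R := fine (M0 setT).

Definition total_mass n : R := initial_mass + n%:R.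

Lemma initial_mass_gt0 : 0 < initial_mass.
Proof.
rewrite fine_gt0// M0_gt0/=.
by rewrite -ge0_fin_numE//; exact: fin_num_measure.
Qed.

Lemma total_mass_gt0 n : 0 < total_mass n.
Proof. by rewrite ltr_pwDl// initial_mass_gt0. Qed.

Lemma total_massS n : total_mass n.+1 = total_mass n + 1.
Proof. by rewrite /total_mass -natr1 addrA. Qed.

Lemma mvpp_total_mass n w : M n w setT = (total_mass n)%:E.
Proof.
elim: n => [|n IH].
  rewrite (mvpp_init hM)// /total_mass addr0 /initial_mass fineK//.
  exact: fin_num_measure.
by rewrite (mvpp_step hM)// IH prob_kernel total_massS EFinD.
Qed.

Let M_ltoo n w : (M n w setT < +oo)%E.
Proof. by rewrite mvpp_total_mass ltry. Qed.

Definition urn_mean n phi w : R := (\int[M n w]_x phi x) / total_mass n.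

Lemma urn_mean_functional n w : bounded_functional (fun phi => urn_mean n phi w).
Proof.
have [D [c b]] := bounded_functional_integral (M_ltoo n w).
split=> [a phi psi b1 b2|]; first by rewrite /urn_mean D// mulrDl mulrA.
exists (c / total_mass n) => B phi bphi phiB.
rewrite normrM normfV (gtr0_norm (total_mass_gt0 n)) mulrAC ler_wpM2r ?invr_ge0//.
  exact/ltW/total_mass_gt0.
exact: b.
Qed.

Lemma urn_mean_le n phi B w : bounded_measurable phi ->
  (forall x, `|phi x| <= B) -> `|urn_mean n phi w| <= B.
Proof.
move=> bphi phiB; have T0 := total_mass_gt0 n.
rewrite normrM normfV (gtr0_norm T0) ler_pdivrMr//.
rewrite (le_trans (le_normr_Rintegral _ (bounded_measurable_integrable (M_ltoo n w) bphi)))//.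
have -> : B * total_mass n = \int[M n w]_x B.
  by rewrite Rintegral_cst// [X in fine X]mvpp_total_mass.
apply: le_Rintegral => //.
- exact: (bounded_measurable_integrable (M_ltoo n w) (bounded_measurable_norm bphi)).
- exact: (bounded_measurable_integrable (M_ltoo n w) (bounded_measurable_cst _ B)).
Qed.

Definition step_weight n : R := (total_mass n.+1)^-1.

Lemma step_weight_gt0 n : 0 < step_weight n.
Proof. by rewrite invr_gt0 total_mass_gt0. Qed.

Lemma urn_meanS n phi w : bounded_measurable phi ->
  urn_mean n.+1 phi w =
  (1 - step_weight n) * urn_mean n phi w
  + step_weight n * kernel_op K phi (C n w).
Proof.
move=> bphi; pose L phi := \int[M n w]_x phi x + kernel_op K phi (C n w).
have -> : urn_mean n.+1 phi w = L phi / total_mass n.+1.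
  congr (_ / _); apply: (bounded_functional_eq
    (bounded_functional_integral (M_ltoo n.+1 w)) (L2 := L) _ _ bphi).
    have [D [c b]] := bounded_functional_integral (M_ltoo n w).
    split=> [a psi1 psi2 b1 b2|].
      by rewrite /L D// kernel_opD//; ring.
    exists (c + 1) => B psi bpsi psiB.
    rewrite (le_trans (ler_normD _ _))// mulrDl mul1r lerD//; first exact: b.
    exact: kernel_op_le.
  move=> A mA; rewrite /L /kernel_op /Rintegral !integral_indic// !setIT.
  rewrite [X in fine X = _](_ : _ = (M n w A + K (C n w) A)%E); last first.
    exact: (mvpp_step hM).
  rewrite fineD//; first exact: fin_num_measure.
  rewrite ge0_fin_numE//; apply: le_lt_trans (kernel_ltoo K (C n w)).
  by apply: le_measure; rewrite ?inE.
rewrite /L /urn_mean /step_weight total_massS.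
have := total_mass_gt0 n; set T := total_mass n => T0.
by field; rewrite !gt_eqF// addr_gt0.
Qed.

Let gens n : set (set Omega) :=
  [set M k @^-1` B | k in `I_n.+1 & B in @evaluation_sets R P].

(** The sample space with the information available at time [n]. *)
Let past n : measurableType _ := g_sigma_algebraType (gens n).

Lemma measurable_past_eval n k A : (k <= n)%N -> measurable A ->
  measurable_fun setT (fun w : past n => M k w A).
Proof.
move=> kn mA _ B mB; rewrite setTI; apply: sub_sigma_algebra.
exists k => //; exists [set mu : finite_measures R P | B (mu A)] => //.
by exists A => //; exists B.
Qed.

Lemma measurable_past_urn_mean n k phi : (k <= n)%N -> bounded_measurable phi ->
  measurable_fun setT (urn_mean k phi : past n -> R).
Proof.
move=> kn bphi; apply: measurable_funM => //.
apply: (@measurable_integral_family _ _ (past n) _ _ (fun w => M k w)) => // [w|A mA].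
  exact: M_ltoo.
exact: measurable_past_eval.
Qed.

Lemma measurable_eval n A : measurable A -> measurable_fun setT (fun w => M n w A).
Proof.
move=> mA; elim: n => [|n IH].
  by under eq_fun do rewrite (mvpp_init hM)//; exact: measurable_cst.
under eq_fun do rewrite (mvpp_step hM)//.
apply: emeasurable_funD => //.
exact: measurableT_comp (measurable_kernel K A mA) (mvpp_color_measurable hM n).
Qed.

Lemma measurable_past n (E : set Omega) :
  measurable (E : set (past n)) -> measurable E.
Proof.
apply: smallest_sub; first exact: sigma_algebra_measurable.
move=> _ [k _ [_ [A mA [B mB <-]] <-]].
by rewrite -[X in measurable X]setTI; exact: measurable_eval.
Qed.

Lemma bounded_measurable_past n (Z : past n -> R) :
  bounded_measurable Z -> bounded_measurable (Z : Omega -> R).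
Proof.
move=> [mZ ZB]; split=> // _ B mB; rewrite setTI.
by apply: (@measurable_past n); rewrite -[X in measurable X]setTI; exact: mZ.
Qed.

Lemma bounded_measurable_urn_mean n k phi : (k <= n)%N -> bounded_measurable phi ->
  bounded_measurable (urn_mean k phi : past n -> R).
Proof.
move=> kn bphi; split; first exact: measurable_past_urn_mean.
by have [_ [B phiB]] := bphi; exists B => w; exact: urn_mean_le.
Qed.

Let E_functional := bounded_functional_integral (probability_ltoo Pr).

(** The law of the colours given the past, extended from events to bounded
    functions in one factor at a time. *)
Lemma mean_color n (Z : past n -> R) phi :
  bounded_measurable Z -> bounded_measurable phi ->
  \int[Pr]_w (Z w * phi (C n w)) = \int[Pr]_w (Z w * urn_mean n phi w).
Proof.
move=> bZ bphi.
have bC psi : bounded_measurable psi -> bounded_measurable (fun w => psi (C n w)).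
  exact: (bounded_measurable_comp (mvpp_color_measurable hM n)).
have bU psi : bounded_measurable psi -> bounded_measurable (urn_mean n psi : Omega -> R).
  by move=> bpsi; apply: (@bounded_measurable_past n); exact: bounded_measurable_urn_mean.
have [DE [c bE]] := E_functional.
have functional_l (Y : Omega -> R) : bounded_measurable Y ->
    bounded_functional (fun Z : past n -> R => \int[Pr]_w (Z w * Y w)).
  move=> bY; split=> [a Z1 Z2 b1 b2|].
    rewrite -DE; [|exact: bounded_measurableM (bounded_measurable_past b1) bY|
                  exact: bounded_measurableM (bounded_measurable_past b2) bY].
    by apply: eq_Rintegral => w _; ring.
  have [_ [B YB]] := bY; exists (c * B) => B' Z1 bZ1 Z1B.
  rewrite mulrAC -mulrA; apply: bE => [|w].
    exact: bounded_measurableM (bounded_measurable_past bZ1) bY.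
  by rewrite normrM ler_pM.
have functional_r (Z1 : past n -> R) (Y : (borel P -> R) -> Omega -> R) :
    bounded_measurable Z1 ->
    (forall psi, bounded_measurable psi -> bounded_measurable (Y psi)) ->
    (forall a psi1 psi2 w, bounded_measurable psi1 -> bounded_measurable psi2 ->
      Y (fun x => a * psi1 x + psi2 x) w = a * Y psi1 w + Y psi2 w) ->
    (forall psi B w, bounded_measurable psi -> (forall x, `|psi x| <= B) ->
      `|Y psi w| <= B) ->
    bounded_functional (fun psi => \int[Pr]_w (Z1 w * Y psi w)).
  move=> bZ1 bY DY YB; have bZ1' := bounded_measurable_past bZ1.
  split=> [a psi1 psi2 b1 b2|].
    rewrite -DE; [|exact: bounded_measurableM bZ1' (bY _ b1)|
                  exact: bounded_measurableM bZ1' (bY _ b2)].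
    by apply: eq_Rintegral => w _; rewrite DY//; ring.
  have [_ [B Z1B]] := bZ1; exists (c * B) => B' psi bpsi psiB.
  rewrite -mulrA; apply: bE => [|w].
    exact: bounded_measurableM bZ1' (bY _ bpsi).
  by rewrite normrM ler_pM// YB.
apply: (bounded_functional_eq (functional_l _ (bC _ bphi))
  (functional_l _ (bU _ bphi)) _ bZ) => E mE.
have bE1 := bounded_measurable_indic R mE.
apply: (bounded_functional_eq
  (functional_r (\1_E) (fun psi w => psi (C n w)) bE1 bC _ _)
  (functional_r (\1_E) (fun psi w => urn_mean n psi w) bE1 bU _ _) _ bphi) => //.
- by move=> a psi1 psi2 w b1 b2; exact: (urn_mean_functional n w).1.
- by move=> psi B w; exact: urn_mean_le.
move=> A mA; have mE' := measurable_past mE.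
have mCA : measurable (C n @^-1` A).
  by rewrite -[X in measurable X]setTI; exact: (mvpp_color_measurable hM n).
transitivity (fine (Pr (E `&` C n @^-1` A))).
  rewrite -[E `&` _]setIT -integral_indic//; last exact: measurableI.
  by congr fine; apply: eq_integral => w _; rewrite indicI.
rewrite (mvpp_color hM)//; transitivity
  (\int[Pr]_(w in E) (fine (M n w A) / fine (M n w setT))) => //.
rewrite Rintegral_mkcond; apply: eq_Rintegral => w _.
rewrite patchE indicE; case: ifPn => _; rewrite ?mul1r ?mul0r//.
rewrite /urn_mean mvpp_total_mass /=; congr (_ / _).
by rewrite /Rintegral integral_indic// setIT.
Qed.

Definition urn_step n phi x : R :=
  (1 - step_weight n) * phi x + step_weight n * kernel_op K phi x.

(** The successive conditional expectations of [urn_mean (j + r) phi] given the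
    past of the times between [j + r] and [j]. *)
Fixpoint urn_back j r phi : borel P -> R :=
  if r is r'.+1 then urn_back j r' (urn_step (j + r') phi) else phi.

Lemma step_weight_le1 n : step_weight n <= 1.
Proof.
rewrite invf_le1 ?total_mass_gt0// total_massS lerDr.
exact/ltW/total_mass_gt0.
Qed.

Lemma bounded_measurable_urn_step n phi : bounded_measurable phi ->
  bounded_measurable (urn_step n phi).
Proof.
move=> bphi; apply: bounded_measurableD; apply: bounded_measurableZ => //.
exact: bounded_measurable_kernel_op.
Qed.

Lemma urn_step_le n phi B : bounded_measurable phi ->
  (forall x, `|phi x| <= B) -> forall x, `|urn_step n phi x| <= B.
Proof.
move=> bphi phiB x; have p0 := step_weight_gt0 n; have p1 := step_weight_le1 n.
have Kphi := kernel_op_le K x bphi phiB.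
rewrite /urn_step; move: (phiB x) Kphi.
rewrite !ler_norml => /andP[? ?] /andP[? ?]; apply/andP; split; nra.
Qed.

Lemma bounded_measurable_urn_back j r phi : bounded_measurable phi ->
  bounded_measurable (urn_back j r phi).
Proof.
by elim: r phi => //= r IH phi bphi; apply: IH; exact: bounded_measurable_urn_step.
Qed.

(** The increments of the martingale of conditional expectations are orthogonal
    and of size [2 * B * step_weight n], since adding a unit mass moves the
    composition of the urn by that much in total variation. *)
Lemma urn_mean_L2 j r phi B : bounded_measurable phi ->
  (forall x, `|phi x| <= B) ->
  \int[Pr]_w (urn_mean (j + r) phi w - urn_mean j (urn_back j r phi) w) ^+ 2 <=
  4 * B ^+ 2 * \sum_(i < r) step_weight (j + i) ^+ 2.
Proof.
have [DE _] := E_functional.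
elim: r phi => [|r IH] phi bphi phiB.
  rewrite big_ord0 mulr0 addn0 /=.
  under eq_Rintegral do rewrite subrr expr0n/=.
  by rewrite Rintegral_cst_probability.
rewrite addnS; set n := (j + r)%N.
pose phi' := urn_step n phi; pose p := step_weight n.
have bphi' : bounded_measurable phi' by exact: bounded_measurable_urn_step.
have bKphi : bounded_measurable (kernel_op K phi) by exact: bounded_measurable_kernel_op.
pose Z : past n -> R := fun w => urn_mean n phi' w - urn_mean j (urn_back j r phi') w.
have bZ : bounded_measurable Z.
  apply: bounded_measurableB; first exact: bounded_measurable_urn_mean.
  by apply: bounded_measurable_urn_mean; [exact: leq_addr|exact: bounded_measurable_urn_back].
pose V w := kernel_op K phi (C n w).
pose U w := urn_mean n (kernel_op K phi) w.
have bZO : bounded_measurable (Z : Omega -> R) := bounded_measurable_past bZ.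
have bV : bounded_measurable V.
  exact: (bounded_measurable_comp (mvpp_color_measurable hM n)).
have bU : bounded_measurable U.
  by apply: (@bounded_measurable_past n); exact: bounded_measurable_urn_mean.
have DE3 w : urn_mean n.+1 phi w - urn_mean j (urn_back j r.+1 phi) w =
    Z w + p * (V w - U w).
  rewrite urn_meanS// /= -/n -/phi' /Z /V /U /phi' /urn_step.
  have [DU _] := urn_mean_functional n w.
  rewrite DU//; last exact: bounded_measurableZ.
  have -> : urn_mean n (fun x => step_weight n * kernel_op K phi x) w =
      step_weight n * urn_mean n (kernel_op K phi) w.
    by rewrite (bounded_functionalZ _ (urn_mean_functional n w)).
  by rewrite /p; ring.
have bVU := bounded_measurableB bV bU.
have bVU2 := bounded_measurableM bVU bVU.
have bZV := bounded_measurableM bZO bV.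
have bZU := bounded_measurableM bZO bU.
have bZZ := bounded_measurableM bZO bZO.
have -> : \int[Pr]_w (urn_mean n.+1 phi w - urn_mean j (urn_back j r.+1 phi) w) ^+ 2 =
    p ^+ 2 * \int[Pr]_w ((V w - U w) * (V w - U w)) + \int[Pr]_w (Z w * Z w).
  transitivity (\int[Pr]_w (p ^+ 2 * ((V w - U w) * (V w - U w)) +
      ((2 * p) * (Z w * V w) + ((- (2 * p)) * (Z w * U w) + Z w * Z w)))).
    by apply: eq_Rintegral => w _; rewrite DE3; ring.
  have b1 := bounded_measurableD (bounded_measurableZ (- (2 * p)) bZU) bZZ.
  have b2 := bounded_measurableD (bounded_measurableZ (2 * p) bZV) b1.
  by rewrite DE// DE// DE// (mean_color bZ bKphi) mulNr addNKr.
have sup2 w : `|(V w - U w) * (V w - U w)| <= 4 * B ^+ 2.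
  have VB : `|V w| <= B by exact: kernel_op_le.
  have UB : `|U w| <= B by apply: urn_mean_le => // x; exact: kernel_op_le.
  have VU : `|V w - U w| <= 2 * B.
    by rewrite mulr_natl mulr2n (le_trans (ler_normB _ _))// lerD.
  rewrite normrM (_ : 4 * B ^+ 2 = (2 * B) * (2 * B)); last by ring.
  exact: ler_pM.
have E2 : \int[Pr]_w ((V w - U w) * (V w - U w)) <= 4 * B ^+ 2.
  rewrite -[leRHS](Rintegral_cst_probability Pr).
  apply: le_Rintegral => //.
  - exact: bounded_measurable_integrable (probability_ltoo Pr) bVU2.
  - exact: bounded_measurable_integrable (probability_ltoo Pr) (bounded_measurable_cst _ _).
  - by move=> w _; exact: le_trans (ler_norm _) (sup2 w).
rewrite big_ord_recr /= mulrDr addrC lerD//.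
  have := IH _ bphi' (urn_step_le n bphi phiB).
  by under eq_Rintegral do rewrite expr2.
by rewrite mulrC ler_wpM2r ?sqr_ge0.
Qed.

End urn.

(** * Conditional expectations as Poisson means *)

Section urn_poisson.
Context (R : realType) (P : ptopologicalType).
Context (K : R.-pker (borel P) ~> (borel P)).
Context (M0 : finite_measures R P) (M0_gt0 : (0 < M0 setT)%E).
Implicit Types (phi : borel P -> R) (x : borel P).

Local Notation p := (step_weight M0).

Definition weight_sum j r : R := \sum_(i < r) p (j + i).

Lemma weight_sum_ge0 j r : 0 <= weight_sum j r.
Proof. by rewrite sumr_ge0// => i _; exact/ltW/step_weight_gt0. Qed.

(** Each step back in time is a Bernoulli step for the number of applications of
    [kernel_op K]; the errors of [poisson_mean_le_cam] add up, since
    [urn_step] does not increase the uniform norm. *)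
Lemma urn_back_poisson j r phi B x : bounded_measurable phi ->
  (forall y, `|phi y| <= B) ->
  `|urn_back K M0 j r phi x
    - poisson_mean (weight_sum j r) (fun k => iter k (kernel_op K) phi x)| <=
  4 * B * \sum_(i < r) p (j + i) ^+ 2.
Proof.
elim: r phi => [|r IH] phi bphi phiB; have iterB k := iter_kernel_op_le K k x bphi phiB.
  by rewrite /weight_sum !big_ord0 mulr0 (poisson_mean0 iterB)/= subrr normr0.
set n := (j + r)%N; have p0 := ltW (step_weight_gt0 M0_gt0 n).
have bphi' := bounded_measurable_urn_step K M0 n bphi.
have phiB' := urn_step_le K M0_gt0 n bphi phiB.
have {IH} := IH _ bphi' phiB'.
have -> : (fun k => iter k (kernel_op K) (urn_step K M0 n phi) x) =
    (fun k => (1 - p n) * iter k (kernel_op K) phi x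
            + p n * iter k.+1 (kernel_op K) phi x).
  apply/funext => k.
  rewrite iterSr (iter_kernel_opD K k (1 - p n) (p n) bphi)//.
  exact: bounded_measurable_kernel_op.
have := poisson_mean_le_cam (weight_sum_ge0 j r) p0 iterB.
rewrite (_ : weight_sum j r + p n = weight_sum j r.+1); last first.
  by rewrite /weight_sum big_ord_recr.
rewrite big_ord_recr /= -/n mulrDr => h1 h2.
rewrite distrC in h1; rewrite -(subrKA (poisson_mean (weight_sum j r)
  (fun k => (1 - p n) * iter k (kernel_op K) phi x + p n * iter k.+1 (kernel_op K) phi x))).
by rewrite (le_trans (ler_normD _ _))// lerD.
Qed.

Let step_weight_le n : p n <= n.+1%:R^-1.
Proof.
rewrite lef_pV2 ?posrE ?total_mass_gt0// /total_mass lerDr.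
exact/ltW/initial_mass_gt0.
Qed.

Lemma sum_step_weight2_le j r : (0 < j)%N ->
  \sum_(i < r) p (j + i) ^+ 2 <= j%:R^-1.
Proof.
move=> j0; rewrite (@le_trans _ _ (j%:R^-1 - (j + r)%:R^-1))//; last first.
  by rewrite lerBlDr lerDl invr_ge0.
elim: r => [|r IH]; first by rewrite big_ord0 addn0 subrr.
rewrite big_ord_recr /=; set n := (j + r)%N in IH *.
have n0 : 0 < n%:R :> R by rewrite ltr0n addn_gt0 j0.
have : p n ^+ 2 <= n%:R^-1 - n.+1%:R^-1.
  have p0 := step_weight_gt0 M0_gt0 n; have p1 := step_weight_le n.
  rewrite (@le_trans _ _ (n.+1%:R^-1 * n.+1%:R^-1))//.
    by rewrite expr2 ler_pM// ltW.
  rewrite -natr1; have -> : n%:R^-1 - (n%:R + 1)^-1 = n%:R^-1 * (n%:R + 1)^-1 :> R.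
    by field; rewrite !gt_eqF// addr_gt0.
  rewrite ler_wpM2r ?invr_ge0 ?addr_ge0 ?(ltW n0)//.
  by rewrite lef_pV2 ?posrE ?addr_gt0// lerDl.
rewrite addnS -/n => pn2; rewrite (le_trans (lerD IH pn2))//.
by rewrite addrA subrK.
Qed.

Let ln_step n : (0 < n)%N -> (n.+1%:R^-1 : R) <= ln (n.+1%:R : R) - ln (n%:R : R) <= n%:R^-1.
Proof.
move=> n0; have nR : 0 < n%:R :> R by rewrite ltr0n.
have nR1 : 0 < n.+1%:R :> R by rewrite ltr0n.
rewrite -ln_div ?posrE//; apply/andP; split.
  have -> : n.+1%:R / n%:R = (1 - n.+1%:R^-1)^-1 :> R.
    rewrite (_ : 1 - n.+1%:R^-1 = n%:R / n.+1%:R) ?invf_div//.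
    by rewrite -natr1; field; rewrite natr1 gt_eqF.
  have lt1 : n.+1%:R^-1 < 1 :> R by rewrite invf_lt1// ltr1n.
  rewrite lnV ?posrE ?subr_gt0// lerNr.
  by rewrite -[1 - _]/(1 + - _) le_ln1Dx// ltrN2.
have -> : n.+1%:R / n%:R = 1 + n%:R^-1 :> R.
  by rewrite -natr1; field; rewrite gt_eqF.
by rewrite le_ln1Dx// (@lt_trans _ _ 0)// ?invr_gt0// ltrN10.
Qed.

(** Both the weights and the increments of the logarithm differ from
    [n%:R^-1] by at most a constant times the telescoping [n%:R^-1 - n.+1%:R^-1]. *)
Lemma weight_sum_ln j : (0 < j)%N ->
  exists c, forall r, `|weight_sum j r - ln (j + r)%:R| <= c.
Proof.
move=> j0; pose m := initial_mass M0; have m0 : 0 < m := initial_mass_gt0 M0_gt0.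
exists (`|ln j%:R| + (m + 1) * j%:R^-1) => r.
suff h : `|weight_sum j r - ln (j + r)%:R + ln j%:R| <=
    (m + 1) * (j%:R^-1 - (j + r)%:R^-1).
  rewrite -[X in `|X|](addrK (ln j%:R)) (le_trans (ler_normB _ _))// addrC lerD//.
  rewrite (le_trans h)// ler_wpM2l ?addr_ge0 ?(ltW m0)//.
  by rewrite lerBlDr lerDl invr_ge0.
elim: r => [|r IH].
  by rewrite /weight_sum big_ord0 addn0 sub0r addNr normr0 subrr mulr0.
rewrite /weight_sum big_ord_recr /= -/(weight_sum j r) addnS.
set n := (j + r)%N in IH *.
have n0 : (0 < n)%N by rewrite addn_gt0 j0.
have nR : 0 < n%:R :> R by rewrite ltr0n.
have /andP[l1 l2] := ln_step n0; have pn := step_weight_le n.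
have pn' : n%:R^-1 - p n <= (m + 1) * (n%:R^-1 - n.+1%:R^-1).
  rewrite /step_weight /total_mass -/m -natr1.
  have -> : n%:R^-1 - (m + (n%:R + 1))^-1 = (m + 1) * (n%:R^-1 * (m + (n%:R + 1))^-1).
    by field; rewrite !gt_eqF// !addr_gt0.
  have -> : n%:R^-1 - (n%:R + 1)^-1 = n%:R^-1 * (n%:R + 1)^-1 :> R.
    by field; rewrite !gt_eqF// addr_gt0.
  rewrite ler_wpM2l ?addr_ge0 ?(ltW m0)// ler_wpM2l ?invr_ge0 ?(ltW nR)//.
  by rewrite lef_pV2 ?posrE ?addr_gt0// lerDr ltW.
have m1 : 0 <= (m + 1) * (n%:R^-1 - n.+1%:R^-1).
  apply: mulr_ge0; first by rewrite addr_ge0// ltW.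
  by rewrite subr_ge0 lef_pV2 ?posrE ?ltr0n// ler_nat.
have incr : `|p n - (ln n.+1%:R - ln n%:R)| <= (m + 1) * (n%:R^-1 - n.+1%:R^-1).
  rewrite ler_norml; apply/andP; split; last first.
    by rewrite (le_trans _ m1)// subr_le0 (le_trans pn l1).
  by rewrite lerNl opprB (le_trans _ pn')// lerD2r.
have -> : (m + 1) * (j%:R^-1 - n.+1%:R^-1) =
    (m + 1) * (j%:R^-1 - n%:R^-1) + (m + 1) * (n%:R^-1 - n.+1%:R^-1) by ring.
have -> : weight_sum j r + p n - ln n.+1%:R + ln j%:R =
    (weight_sum j r - ln n%:R + ln j%:R) + (p n - (ln n.+1%:R - ln n%:R)) by ring.
by rewrite (le_trans (ler_normD _ _))// lerD.
Qed.

Lemma bounded_measurable_poisson_mean lam phi : 0 <= lam -> bounded_measurable phi ->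
  bounded_measurable (fun x => poisson_mean lam (fun k => iter k (kernel_op K) phi x)).
Proof.
move=> l0 bphi; have [_ [B phiB]] := bphi.
have iterB x k := iter_kernel_op_le K k x bphi phiB.
split; last by exists B => x; exact: poisson_mean_le.
apply: (measurable_fun_cvg (h := fun m x =>
    series (fun k => poisson_weight lam k * iter k (kernel_op K) phi x) m)).
  move=> m; apply: measurable_sum => k; apply: measurable_funM => //.
  by have [] := bounded_measurable_iter K k bphi.
by move=> x _; exact: (is_cvg_poisson_mean (iterB x)).
Qed.

End urn_poisson.

(** * Convergence of the urn *)

Section weak_limit_in_probability.
Context (R : realType) (P : ptopologicalType).
Context d (Omega : measurableType d) (Pr : probability Omega R).

(** The sets in which [Y n] lies with outer probability tending to 1 form a
    filter, so that it suffices to test the subbasic neighbourhoods. *)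
Lemma cvg_in_probability_weak (Y : nat -> Omega -> finite_measures R P)
    (nu : finite_measures R P) :
  (forall (h : bounded_continuous R P) e, 0 < e ->
    mu_ext Pr [set w | ~ (`|integrals nu h - integrals (Y n w) h| <= e)]
      @[n --> \oo] --> 0%E) ->
  cvg_in_probability Pr (T := weak_measures R P) Y nu.
Proof.
move=> cvY.
pose likely : set_system (weak_measures R P) := fun U =>
  mu_ext Pr [set w | ~ U (Y n w)] @[n --> \oo] --> 0%E.
have mu0 A : (0 <= mu_ext Pr A)%E by exact: mu_ext_ge0.
have lik (U : set (weak_measures R P)) (v : nat -> \bar R) : v n @[n --> \oo] --> 0%E ->
    (forall n, mu_ext Pr [set w | ~ U (Y n w)] <= v n)%E -> likely U.
  move=> v0 Uv; apply: (squeeze_cvge _ (cvg_cst _) v0); apply: nearW => n.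
  by rewrite mu0 Uv.
have filter_likely : Filter likely.
  split.
  - apply: (lik _ (cst 0%E)); first exact: cvg_cst.
    move=> n; rewrite (_ : [set w | _] = set0) ?mu_ext0//.
    by apply/seteqP; split=> // w /=; apply.
  - move=> U V lU lV.
    pose v n := (mu_ext Pr [set w | ~ U (Y n w)] + mu_ext Pr [set w | ~ V (Y n w)])%E.
    apply: (lik _ v) => [|n].
      by rewrite -[X in _ --> X]adde0; apply: cvgeD lU lV.
    apply: le_trans (outer_measureU2 (mu_ext Pr : {outer_measure set Omega -> \bar R}) _ _).
    apply: le_mu_ext => w /= nUV; apply: contrapT => /not_orP[/contrapT UY /contrapT VY].
    by apply: nUV; split.
  - move=> U V UV lU; apply: (lik _ _ lU) => n; apply: le_mu_ext => w /=.
    by apply: contra_not; exact: UV.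
suff cvl : likely --> (nu : weak_measures R P) by move=> U /cvl.
move=> U; rewrite nbhsE => -[V [[A oA AV] Vnu] VU]; apply: filterS VU _.
rewrite -AV.
have cvh (h : bounded_continuous R P) : integrals x h @[x --> likely] --> integrals nu h.
  by apply/cvgrPdist_le => e e0; exact: cvY.
suff cvI : integrals x @[x --> likely] --> (integrals nu).
  by apply: cvI; rewrite nbhsE; exists A => //; split=> //; move: Vnu; rewrite -AV.
apply/cvg_sup => h B; rewrite nbhsE => -[_ [[B' oB' <-] B'nu] sB].
by apply: filterS sB _; apply: (cvh h); exact: open_nbhs_nbhs.
Qed.
End weak_limit_in_probability.

Lemma integrals_Theta (R : realType) (P : ptopologicalType) (N : normalization R P)
    (s : scalars N) (v : offsets N) (c : {nonneg R}) (mu : finite_measures R P)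
    (h : bounded_continuous R P) :
  integrals (Theta N s v (mscale c mu) : finite_measures R P) h =
  c%:num * \int[mu]_x sval h (normalize N s v x).
Proof.
have bh := bounded_measurable_comp (measurable_normalize s v) (bounded_measurable_sval h).
have fin_ltoo (nu : finite_measures R P) : (nu setT < +oo)%E.
  by rewrite -ge0_fin_numE// fin_num_measure.
rewrite /integrals.
transitivity (\int[mscale c mu]_x sval h (normalize N s v x)).
  rewrite /Rintegral; congr fine.
  transitivity (\int[pushforward (mscale c mu) (normalize N s v : borel P -> borel P)]_x
    (sval h x)%:E)%E => //.
  rewrite integral_pushforward ?preimage_setT//.
  - exact: measurable_normalize.
  - by apply/measurable_EFinP; have [] := bounded_measurable_sval h.
  - by apply: bounded_measurable_integrable => //; exact: fin_ltoo.
apply: (bounded_functional_eq (bounded_functional_integral (fin_ltoo (mscale c mu)))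
  (L2 := fun phi => c%:num * \int[mu]_x phi x) _ _ bh).
  have [D [k b]] := bounded_functional_integral (fin_ltoo mu); split=> [t phi psi b1 b2|].
    by rewrite D// mulrDr mulrCA.
  exists (c%:num * k) => B phi bphi phiB.
  by rewrite normrM ger0_norm// -mulrA ler_wpM2l// b.
move=> A mA; rewrite /Rintegral !integral_indic// !setIT /= /mscale /= fineM//.
exact: fin_num_measure.
Qed.

Section mvpp_limit.
Context (R : realType) (P : ptopologicalType) (pP : polish R P).
Context (N : normalization R P) (K : R.-pker (borel P) ~> (borel P)).
Context (a : nat -> scalars N) (b : nat -> offsets N).
Hypothesis ua : forall n, sunit (a n).
Context (gamma : probability (borel P) R) (erg : ergodic K a b gamma).
Context (f : R -> offsets N) (g : R -> scalars N).
Hypotheses (mf : borel_measurable (f : measurableTypeR R -> offsets N)).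
Hypotheses (mg : borel_measurable (g : measurableTypeR R -> scalars N)).
Hypothesis fluct : regular_fluctuations a b f g.
Context (M0 : finite_measures R P) (M0_gt0 : (0 < M0 setT)%E).
Context d (Omega : measurableType d) (Pr : probability Omega R).
Context (C : nat -> Omega -> borel P) (M : nat -> Omega -> finite_measures R P).
Hypothesis hM : mvpp Pr M0 K C M.
Context (h : bounded_continuous R P).

Let log_floor (n : nat) : nat := Num.truncn (ln (n%:R : R)).
Let l : R := \int[limit_measure pP mf mg gamma]_x sval h x.
Let phi n : borel P -> R := normalized_test a b h (log_floor n).

Let bphi n : bounded_measurable (phi n).
Proof. exact: bounded_measurable_normalized_test. Qed.

Let log_floor_le n : (0 < n)%N -> `|ln (n%:R : R) - (log_floor n)%:R| <= 1.
Proof.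
move=> n0; have := @truncn_itv R (ln n%:R) (ln_ge0 _); rewrite ler1n => /(_ n0).
by rewrite -/(log_floor n) -natr1 ler_norml => /andP[? ?]; apply/andP; split; lra.
Qed.

Let cvg_log_floor j : (log_floor (j + n.+1))%:R @[n --> \oo] --> (+oo : set_system R).
Proof.
apply/cvgryPge => A; near=> n.
have nj : (0 < j + n.+1)%N by rewrite addnS.
have An : A + 1 <= ln (j + n.+1)%:R.
  rewrite -ler_expR lnK ?posrE ?ltr0n// (@le_trans _ _ n%:R)//.
    by near: n; exact: nbhs_infty_ger.
  by rewrite ler_nat addnS ltnW// ltnS leq_addl.
by have := log_floor_le nj; rewrite ler_norml => /andP[_ ?]; lra.
Unshelve. all: by end_near. Qed.

Let bounded_measurable_urn j psi : bounded_measurable psi ->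
  bounded_measurable (urn_mean M0 M j psi : Omega -> R).
Proof.
move=> bpsi; apply: (bounded_measurable_past hM (n := j)).
exact: (bounded_measurable_urn_mean M0_gt0 hM (leqnn j)).
Qed.

(** With [j] fixed, [urn_mean] at time [n] minus the limit is the sum of three
    terms: a martingale increment since time [j], bounded by [urn_mean_L2], the
    error of the Poisson approximation, bounded by [urn_back_poisson], and a term
    that vanishes as [n] grows by [cvg_poisson_mean_chain] and dominated
    convergence. *)
Lemma cvg_urn_mean_L2 :
  \int[Pr]_w (urn_mean M0 M n (phi n) w - l) ^+ 2 @[n --> \oo] --> 0.
Proof.
have [_ [B hB]] := svalP h.
have phiB n x : `|phi n x| <= B by exact: hB.
have B0 : 0 <= B := le_trans (normr_ge0 _) (hB point).
apply/cvgr0Pnorm_le => e e0.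
(* the first two terms contribute at most [3 * 4] and [3 * 16] times
   [B ^+ 2 / j], by convexity of the square *)
pose j := (Num.truncn (120 * B ^+ 2 / e)).+1.
have j0 : (0 < j)%N by [].
have jR : 1 <= j%:R :> R by rewrite ler1n.
have je : 60 * B ^+ 2 * j%:R^-1 <= e / 2.
  rewrite ler_pdivrMr ?ltr0n// mulrAC ler_pdivlMr//.
  have : 120 * B ^+ 2 / e < j%:R by exact: truncnS_gt.
  by rewrite ltr_pdivrMr// => /ltW; lra.
pose lam r := weight_sum M0 j r.+1.
pose n_ r := (j + r.+1)%N.
pose S r x := poisson_mean (lam r) (fun k => iter k (kernel_op K) (phi (n_ r)) x).
pose Q r := urn_back K M0 j r.+1 (phi (n_ r)).
have lam0 r : 0 < lam r.
  rewrite /lam /weight_sum big_ord_recr /= ltr_wpDl ?step_weight_gt0//.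
  exact: (weight_sum_ge0 M0_gt0 j r).
have bS r : bounded_measurable (S r).
  by apply: bounded_measurable_poisson_mean => //; exact/ltW.
have bQ r : bounded_measurable (Q r) by exact: bounded_measurable_urn_back.
have SB r x : `|S r x| <= B.
  by apply: poisson_mean_le (ltW (lam0 r)) _ => k; exact: iter_kernel_op_le.
have [c lamc] := weight_sum_ln M0_gt0 j0.
have cvS x : S r x @[r --> \oo] --> l.
  apply: (@cvg_poisson_mean_chain R P pP N K a b ua gamma erg f g mf mg fluct h
    (c + 1) lam (fun r => log_floor (n_ r)) x) => //.
  - move=> r; have := lamc r.+1; rewrite -/(n_ r) -/(lam r) => h1.
    have h2 : `|ln ((n_ r)%:R : R) - (log_floor (n_ r))%:R| <= 1.
      by apply: log_floor_le; rewrite /n_ addnS.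
    rewrite -(subrKA (ln (n_ r)%:R)) (le_trans (ler_normD _ _))// lerD//.
  - exact: cvg_log_floor.
have M_ltoo w : (M j w setT < +oo)%E by rewrite (mvpp_total_mass hM) ltry.
have T0 := total_mass_gt0 M0_gt0 j.
have cvu w : urn_mean M0 M j (S r) w @[r --> \oo] --> l.
  have -> : l = (\int[M j w]_x l) / total_mass M0 j.
    rewrite Rintegral_cst// [X in fine X](mvpp_total_mass hM) mulfK//.
    by rewrite gt_eqF.
  apply: cvgM; last exact: cvg_cst.
  apply: (@cvg_Rintegral_bounded _ _ _ _ S (fun=> l) B) => // [|r].
    exact: M_ltoo.
  by have [] := bS r.
have bu r : bounded_measurable (urn_mean M0 M j (S r) : Omega -> R).
  exact: bounded_measurable_urn.
have bl : bounded_measurable (fun _ : Omega => l) by exact: bounded_measurable_cst.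
have bV r := bounded_measurableM (bounded_measurableB (bu r) bl)
  (bounded_measurableB (bu r) bl).
have cvV : \int[Pr]_w ((urn_mean M0 M j (S r) w - l) * (urn_mean M0 M j (S r) w - l))
    @[r --> \oo] --> 0.
  rewrite -[X in _ --> X](Rintegral_cst_probability Pr).
  apply: (@cvg_Rintegral_bounded _ _ _ _ _ _ ((B + `|l|) * (B + `|l|))).
  - exact: probability_ltoo.
  - by move=> r; have [] := bV r.
  - move=> r w; have ul : `|urn_mean M0 M j (S r) w - l| <= B + `|l|.
      by rewrite (le_trans (ler_normB _ _))// lerD2r (urn_mean_le M0_gt0 hM).
    by rewrite normrM ler_pM.
  - move=> w; have ul : urn_mean M0 M j (S r) w - l @[r --> \oo] --> 0.
      by rewrite -(subrr l); apply: cvgB; [exact: cvu|exact: cvg_cst].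
    by rewrite -(mulr0 0); apply: cvgM.
have e6 : 0 < e / 6 by rewrite divr_gt0.
suff : \forall r \near \oo,
    `|\int[Pr]_w (urn_mean M0 M (n_ r) (phi (n_ r)) w - l) ^+ 2| <= e.
  move=> [r0 _ hr]; exists (n_ r0) => // n /= r0n.
  rewrite /n_ addnS -addSn in r0n.
  have <- : n_ (n - j.+1)%N = n.
    by rewrite /n_ addnS -addSn subnKC// (leq_trans _ r0n)// leq_addr.
  by apply: hr => /=; rewrite leq_subRL ?(leq_trans _ r0n)// leq_addr.
move/cvgr0Pnorm_le : cvV => /(_ _ e6); apply: filterS => r V6.
set n := n_ r; set V := \int[Pr]_w _ in V6.
pose A w := urn_mean M0 M n (phi n) w - urn_mean M0 M j (Q r) w.
pose D w := urn_mean M0 M j (Q r) w - urn_mean M0 M j (S r) w.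
pose E w := urn_mean M0 M j (S r) w - l.
have bA : bounded_measurable A by apply: bounded_measurableB; exact: bounded_measurable_urn.
have bD : bounded_measurable D by apply: bounded_measurableB; exact: bounded_measurable_urn.
have bE : bounded_measurable E by exact: bounded_measurableB.
have DB w : `|D w| <= 4 * B * j%:R^-1.
  have -> : D w = urn_mean M0 M j (fun x => Q r x - S r x) w.
    have [DU _] := urn_mean_functional M0_gt0 hM j w.
    rewrite /D addrC -mulN1r -DU//; congr (urn_mean _ _ _ _ _); apply/funext => x.
    by ring.
  apply: (urn_mean_le M0_gt0 hM) => [|x]; first exact: bounded_measurableB.
  rewrite (le_trans (urn_back_poisson K M0_gt0 j r.+1 x (bphi n) (phiB n)))//.
  rewrite ler_wpM2l ?mulr_ge0//; exact: sum_step_weight2_le.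
have EA : \int[Pr]_w (A w * A w) <= 4 * B ^+ 2 * j%:R^-1.
  have := urn_mean_L2 M0_gt0 hM j r.+1 (bphi n) (phiB n).
  rewrite -/(Q r) -/(n_ r) -/n; under eq_Rintegral do rewrite expr2.
  move=> /le_trans; apply; rewrite ler_wpM2l ?mulr_ge0 ?sqr_ge0//.
  exact: sum_step_weight2_le.
pose dlt := 4 * B * j%:R^-1.
have bsum : bounded_measurable (fun w => 3 * (A w * A w) + (3 * (E w * E w) + 3 * dlt ^+ 2)).
  apply: bounded_measurableD; first exact/bounded_measurableZ/bounded_measurableM.
  apply: bounded_measurableD; last exact: bounded_measurable_cst.
  exact/bounded_measurableZ/bounded_measurableM.
have bn : bounded_measurable (fun w => (urn_mean M0 M n (phi n) w - l) ^+ 2).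
  under eq_fun do rewrite expr2.
  apply: bounded_measurableM; apply: bounded_measurableB => //;
    exact: bounded_measurable_urn.
have [DPr _] := bounded_functional_integral (probability_ltoo Pr).
have j1 : j%:R^-1 <= 1 :> R by rewrite invf_le1 ?ltr0n.
have dlt2 : dlt ^+ 2 <= 16 * B ^+ 2 * j%:R^-1.
  have -> : dlt ^+ 2 = 16 * B ^+ 2 * (j%:R^-1 * j%:R^-1) by rewrite /dlt; ring.
  rewrite ler_wpM2l ?mulr_ge0 ?sqr_ge0//.
  by rewrite -[leRHS]mulr1 ler_wpM2l ?invr_ge0.
rewrite ger0_norm; last by apply: Rintegral_ge0 => w _; exact: sqr_ge0.
rewrite (@le_trans _ _ (\int[Pr]_w (3 * (A w * A w) + (3 * (E w * E w) + 3 * dlt ^+ 2))))//.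
  apply: le_Rintegral => //.
  - exact: bounded_measurable_integrable (probability_ltoo Pr) bn.
  - exact: bounded_measurable_integrable (probability_ltoo Pr) bsum.
  move=> w _; have -> : urn_mean M0 M n (phi n) w - l = A w + D w + E w.
    by rewrite /A /D /E; ring.
  have : D w ^+ 2 <= dlt ^+ 2.
    by rewrite -(real_normK (num_real (D w))) lerXn2r ?nnegrE// (le_trans _ (DB w)).
  have := sqr_ge0 (A w - D w); have := sqr_ge0 (A w - E w).
  by have := sqr_ge0 (D w - E w); lra.
rewrite DPr; [|exact: bounded_measurableM|]; last first.
  apply: bounded_measurableD; last exact: bounded_measurable_cst.
  exact/bounded_measurableZ/bounded_measurableM.
rewrite DPr; [|exact: bounded_measurableM|exact: bounded_measurable_cst].
rewrite (Rintegral_cst_probability Pr) -/V.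
by move: V6; rewrite ler_norml => /andP[_ ?]; lra.
Qed.

Definition normalized_urn (n : nat) (w : Omega) : finite_measures R P :=
  Theta N (a (log_floor n)) (b (log_floor n)) (mscale (n%:R^-1)%:nng (M n w)).

(** Chebyshev's inequality. Dividing by [n] instead of [total_mass M0 n] changes
    the integral by [O(1 / n)]. *)
Lemma cvg_urn_deviation e : 0 < e ->
  mu_ext Pr [set w | ~ (`|l - integrals (normalized_urn n w) h| <= e)] @[n --> \oo] --> 0%E.
Proof.
move=> e0; pose m := initial_mass M0.
have [_ [B hB]] := svalP h.
have phiB n x : `|phi n x| <= B by exact: hB.
pose u n w := urn_mean M0 M n (phi n) w.
have bu n : bounded_measurable (u n) by exact: bounded_measurable_urn.
have ThetaE n w : (0 < n)%N ->
    integrals (normalized_urn n w) h = u n w + m / n%:R * u n w.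
  move=> n0; rewrite integrals_Theta /= /u /urn_mean /total_mass -/m.
  have m0 : 0 < m := initial_mass_gt0 M0_gt0.
  have nR : 0 < n%:R :> R by rewrite ltr0n.
  rewrite -/(\int[M n w]_x phi n x); set I := Rintegral _ _ _.
  by field; rewrite !gt_eqF// addr_gt0.
pose D n := [set w | e / 2 <= `|u n w - l|].
have bn n : bounded_measurable (fun w => (u n w - l) * (u n w - l)).
  by apply: bounded_measurableM; apply: bounded_measurableB => //;
    exact: bounded_measurable_cst.
have bnorm n : bounded_measurable (fun w => `|u n w - l|).
  apply/bounded_measurable_norm/bounded_measurableB => //.
  exact: bounded_measurable_cst.
have mD n : measurable (D n).
  rewrite /D (_ : [set w | _] = (fun w => `|u n w - l|) @^-1` `[e / 2, +oo[%classic).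
    by rewrite -[_ @^-1` _]setTI; apply: (bnorm n).1.
  by apply/seteqP; split => w /=; rewrite in_itv/= andbT.
have PrD n : fine (Pr (D n)) <= 4 / e ^+ 2 * \int[Pr]_w (u n w - l) ^+ 2.
  under eq_Rintegral do rewrite expr2.
  rewrite -(bounded_functionalZ _ (bounded_functional_integral (probability_ltoo Pr)))//.
  rewrite -[D n]setIT -[X in fine X]integral_indic//.
  apply: le_Rintegral => //.
  - exact: (bounded_measurable_integrable (probability_ltoo Pr)
      (bounded_measurable_indic _ (mD n))).
  - exact: (bounded_measurable_integrable (probability_ltoo Pr)
      (bounded_measurableZ _ (bn n))).
  move=> w _; rewrite indicE; case: (boolP (w \in D n)) => [|_]; last first.
    by rewrite mulr_ge0 ?divr_ge0 ?sqr_ge0// -expr2 sqr_ge0.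
  rewrite inE /D /= => eu; rewrite mulrAC ler_pdivlMr ?exprn_gt0// mul1r.
  rewrite -expr2 -(real_normK (num_real (u n w - l))).
  have : (e / 2) ^+ 2 <= `|u n w - l| ^+ 2.
    by rewrite lerXn2r ?nnegrE// divr_ge0// ltW.
  by rewrite expr_div_n; lra.
have sub_D : \forall n \near \oo,
    [set w | ~ (`|l - integrals (normalized_urn n w) h| <= e)] `<=` D n.
  have e20 : 0 < e / 2 by rewrite divr_gt0.
  near=> n.
  have n0 : (0 < n)%N by near: n; exact: nbhs_infty_gt.
  have nR : 0 < n%:R :> R by rewrite ltr0n.
  have mBn : m * B / n%:R <= e / 2.
    rewrite ler_pdivrMr// [leRHS]mulrC -ler_pdivrMr//.
    by near: n; exact: nbhs_infty_ger.
  move=> w /= bad; rewrite /D /= leNgt; apply/negP => small; apply: bad.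
  rewrite ThetaE// opprD addrA (le_trans (ler_normB _ _))//.
  rewrite [leRHS](splitr e) lerD//; first by rewrite distrC ltW.
  rewrite (le_trans _ mBn)// normrM mulrAC ger0_norm; last first.
    by rewrite divr_ge0 ?ltW ?initial_mass_gt0.
  rewrite ler_wpM2l ?divr_ge0 ?(ltW (initial_mass_gt0 M0_gt0))//.
  exact: (urn_mean_le M0_gt0 hM).
have cv0 : (4 / e ^+ 2 * \int[Pr]_w (u n w - l) ^+ 2)%:E @[n --> \oo] --> 0%E.
  apply: cvg_EFin; first exact: nearW.
  rewrite -(mulr0 (4 / e ^+ 2)); apply: cvgM; first exact: cvg_cst.
  exact: cvg_urn_mean_L2.
apply: (squeeze_cvge _ (cvg_cst _) cv0); apply: filterS sub_D => n subD.
apply/andP; split; first exact: mu_ext_ge0.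
apply: le_trans (le_mu_ext Pr subD) _.
apply: (@le_trans _ _ (fine (Pr (D n)))%:E); last by rewrite lee_fin; exact: PrD.
by rewrite [leLHS]measurable_mu_extE// fineK// fin_num_measure.
Unshelve. all: by end_near. Qed.

End mvpp_limit.


Theorem theorem4 (R : realType) (P : ptopologicalType) (pP : polish R P)
    (N : normalization R P)
    (K : R.-pker (borel P) ~> (borel P))
    (a : nat -> scalars N) (b : nat -> offsets N)
    (ua : forall n, sunit (a n))
    (gamma : probability (borel P) R)
    (erg : ergodic K a b gamma)
    (f : R -> offsets N) (g : R -> scalars N)
    (mf : borel_measurable (f : measurableTypeR R -> offsets N))
    (mg : borel_measurable (g : measurableTypeR R -> scalars N))
    (fluct : regular_fluctuations a b f g)
    (M0 : finite_measures R P) (M0_gt0 : (0 < M0 setT)%E)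
    (d : measure_display) (Omega : measurableType d) (Pr : probability Omega R)
    (C : nat -> Omega -> borel P) (M : nat -> Omega -> finite_measures R P)
    (hM : mvpp Pr M0 K C M) :
  let log_floor (n : nat) := Num.truncn (ln (n%:R : R)) in
  cvg_in_probability Pr (T := weak_measures R P)
    (fun n w => Theta N (a (log_floor n)) (b (log_floor n))
       (mscale (n%:R^-1)%:nng (M n w)))
    (limit_measure pP mf mg gamma).
Proof.
apply: cvg_in_probability_weak => h e e0.
exact: (cvg_urn_deviation pP ua erg mf mg fluct M0_gt0 hM).
Qed.
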